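(* There is a polynomial-time algorithm that, given a CNF-formula $F$ whose hypergraph $\mathcal H(F)$ is $\beta$-acyclic, computes the maximum number of clauses of $F$ that can be simultaneously satisfied by an assignment of $\mathrm{var}(F)$ (the problem $\mathrm{MaxSAT}$).
   Context: The hypergraph of a CNF-formula $F$ is $\mathcal H(F)=(\mathrm{var}(F),\{\mathrm{var}(C)\mid C\text{ a clause of }F\})$. For a hypergraph $\mathcal H$ and vertex set $S$, $\mathcal H\setminus S$ is the hypergraph on $V(\mathcal H)\setminus S$ with edges $\{e\setminus S\mid e\in E(\mathcal H)\}\setminus\{\emptyset\}$. A vertex $x$ is a nest point of $\mathcal H$ if the edges containing $x$ are totally ordered by inclusion. A $\beta$-elimination order of $\mathcal H$ is a sequence $(x_1,\dots,x_n)$ enumerating $V(\mathcal H)$ such that $x_1$ is a nest point of $\mathcal H$ and $(x_2,\dots,x_n)$ is a $\beta$-elimination order of $\mathcal H\setminus x_1$. $\mathcal H$ is $\beta$-acyclic if it has a $\beta$-elimination order. *)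

(* Defs.v *)
From Corelib Require Import BinNums.
From mathcomp Require Import all_boot finmap.
Set Implicit Arguments. Unset Strict Implicit. Unset Printing Implicit Defensive.
Local Open Scope fset_scope.

(* CNF formulas.  Variables are natural numbers; a literal is a pair *)
(* (x, b): b = true is the positive literal x, b = false is ~x.      *)
(* A clause is given as a list of literals (read as a set), a        *)
(* formula as a list of clauses (read as a set: see wf_cnf).         *)
Definition literal := (nat * bool)%type.
Definition clause := seq literal.
Definition cnf := seq clause.

Definition wf_cnf (F : cnf) : bool := uniq [seq [fset l | l in C] | C <- F].

Definition var_clause (C : clause) : {fset nat} := [fset l.1 | l in C].
Definition var_cnf (F : cnf) : {fset nat} := \bigcup_(C <- F) var_clause C.

(* An assignment (only its values on var(F) matter). *)
Definition sat_clause (a : nat -> bool) (C : clause) : bool :=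
  has (fun l : literal => a l.1 == l.2) C.
Definition num_sat (a : nat -> bool) (F : cnf) : nat := count (sat_clause a) F.

Definition is_maxsat_value (F : cnf) (m : nat) : Prop :=
  (exists a : nat -> bool, num_sat a F = m) /\
  (forall a : nat -> bool, num_sat a F <= m).

Record hypergraph := Hypergraph { hV : {fset nat}; hE : {fset {fset nat}} }.

Definition hyp_of_cnf (F : cnf) : hypergraph :=
  Hypergraph (var_cnf F) [fset var_clause C | C in F].

Definition hdel (H : hypergraph) (S : {fset nat}) : hypergraph :=
  Hypergraph (hV H `\` S)
             ([fset e `\` S | e in hE H] `\` [fset (fset0 : {fset nat})]).

Definition nest_point (H : hypergraph) (x : nat) : Prop :=
  forall e1 e2, e1 \in hE H -> e2 \in hE H -> x \in e1 -> x \in e2 ->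
    (e1 `<=` e2) || (e2 `<=` e1).

Fixpoint beta_elim_order (H : hypergraph) (s : seq nat) : Prop :=
  match s with
  | [::] => hV H = fset0
  | x :: s' => x \in hV H /\ nest_point H x /\ beta_elim_order (hdel H [fset x]) s'
  end.

Definition beta_acyclic (H : hypergraph) : Prop := exists s, beta_elim_order H s.

Inductive Sym := S_blank | S_0 | S_1 | S_pos | S_neg | S_end.

Inductive Move := MoveL | MoveR | MoveN.

Record TM := {
  tm_state : finType;
  tm_gam : finType;
  tm_sym : Sym -> tm_gam;
  tm_sym_inj : injective tm_sym;
  tm_start : tm_state;
  tm_halt : pred tm_state;
  tm_delta : tm_state -> tm_gam -> tm_state * tm_gam * Move }.

Arguments tm_sym : clear implicits.
Arguments tm_start : clear implicits.
Arguments tm_halt : clear implicits.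
Arguments tm_delta : clear implicits.
Arguments tm_sym_inj : clear implicits.

Definition blank (M : TM) : tm_gam M := tm_sym M S_blank.

(* state, reversed left part of tape, scanned cell, right part of tape *)
Definition config (M : TM) :=
  (tm_state M * seq (tm_gam M) * tm_gam M * seq (tm_gam M))%type.

Definition tm_step (M : TM) (c : config M) : config M :=
  let: (q, l, a, r) := c in
  if tm_halt M q then c else
  let: (q', w, mv) := tm_delta M q a in
  match mv with
  | MoveN => (q', l, w, r)
  | MoveL => match l with
             | [::] => (q', [::], blank M, w :: r)
             | x :: l' => (q', l', x, w :: r)
             end
  | MoveR => match r with
             | [::] => (q', w :: l, blank M, [::])
             | x :: r' => (q', w :: l, x, r')
             end
  end.

Definition tm_run (M : TM) (t : nat) (c : config M) : config M := iter t (@tm_step M) c.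

Definition tm_init (M : TM) (w : seq Sym) : config M :=
  match w with
  | [::] => (tm_start M, [::], blank M, [::])
  | x :: w' => (tm_start M, [::], tm_sym M x, map (tm_sym M) w')
  end.

Definition halted (M : TM) (c : config M) : bool :=
  let: (q, _, _, _) := c in tm_halt M q.

Fixpoint upto_blank (M : TM) (s : seq (tm_gam M)) : seq (tm_gam M) :=
  match s with
  | [::] => [::]
  | x :: s' => if x == blank M then [::] else x :: upto_blank s'
  end.

Definition tm_output (M : TM) (c : config M) : seq (tm_gam M) :=
  let: (_, _, a, r) := c in upto_blank (a :: r).

(* Encodings (numbers in binary, big-endian).                        *)
Fixpoint pos_bits (p : positive) : seq Sym :=
  match p with
  | xH => [:: S_1]
  | xO p' => rcons (pos_bits p') S_0
  | xI p' => rcons (pos_bits p') S_1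
  end.

Definition nat_bits (n : nat) : seq Sym :=
  match bin_of_nat n with
  | N0 => [:: S_0]
  | Npos p => pos_bits p
  end.

Definition enc_lit (l : literal) : seq Sym :=
  (if l.2 then S_pos else S_neg) :: nat_bits l.1.
Definition enc_clause (C : clause) : seq Sym :=
  flatten (map enc_lit C) ++ [:: S_end].
Definition enc_cnf (F : cnf) : seq Sym := flatten (map enc_clause F).

(* Main.v *)
(** Let [x] be a nest point and [T] the set of clauses containing [x], whose variable sets
    form a chain.  Take [Ci] in [T] with the largest variable set.  Under an assignment
    falsifying [Ci] without its [x]-literal, a clause [Cj] of [T] other than [Ci] is
    falsified by one value of [x] when [Cj] is included in [Ci], and by the other value when
    it is included in [Ci] up to the sign of [x].  Hence removing [Ci] from [T] lowers the
    minimum over [x] of the number of falsified clauses by a 0/1 amount: the cost of [Ci]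
    without [x] if the clauses of the second kind outnumber those of the first, and 0
    otherwise.  Peeling [T] from the top therefore eliminates [x] by shortening some clauses
    and deleting the others, without changing the minimum number of falsified clauses.  Once
    no literal is left, the deleted clauses are exactly those that can be satisfied together.
    Nest points are found greedily: eliminating any of them preserves beta-acyclicity.

    Since clauses only shrink or disappear, all this can be done in place on the input by
    flagging its cells.  Counts are compared by cancelling flags in pairs, and variable names
    bit by bit, so that the whole computation is a polynomially long sequence of finite-state
    passes over the tape. *)

From HB Require Import structures.
Require Import Defs.
From mathcomp Require Import all_boot finmap zify.
Set Implicit Arguments. Unset Strict Implicit. Unset Printing Implicit Defensive.

(** Whether [x] is a nest point is never tested beforehand. Peeling is attempted for any variable,
    and a clause is peeled only if its variables cover those of every unpeeled clause; this
    condition alone makes the step exact, whatever the shape of the formula. The nest property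
    enters only through progress: a stuck attempt leaves, for each unpeeled clause, another one that
    it does not cover, and for a nest point this would produce ever larger clauses. Abandoning an
    attempt costs nothing, since peeling only records decisions in flags; literals and clauses are
    deleted once all of [T] is peeled. Beta-acyclicity then ensures that some attempt succeeds as
    long as a literal is left.

    Only minima are compared, so no optimal assignment has to be carried along. Most flags are
    scratch data of the passes; the invariants are therefore stated on the quotient [view], which
    forgets them. *)

(** * Falsified clauses and the peeling of one clause *)

Definition vars (C : clause) : seq nat := [seq l.1 | l <- C].
Definition falsified (a : nat -> bool) (F : cnf) : nat :=
  count (fun C => ~~ sat_clause a C) F.
Definition assign (a : nat -> bool) (x : nat) (b : bool) : nat -> bool :=
  fun y => if y == x then b else a y.
Definition dropv (x : nat) (C : clause) : clause := [seq l <- C | l.1 != x].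
Definition minb (x : nat) (a : nat -> bool) (f : (nat -> bool) -> nat) : nat :=
  minn (f (assign a x false)) (f (assign a x true)).

Lemma minbE x a f b :
  minb x a f = minn (f (assign a x b)) (f (assign a x (~~ b))).
Proof. by case: b; rewrite /minb // minnC. Qed.

Lemma eq_minb x a f g : f =1 g -> minb x a f = minb x a g.
Proof. by move=> fg; rewrite /minb !fg. Qed.

Lemma unsat_clauseE a C : ~~ sat_clause a C = all (fun l => a l.1 != l.2) C.
Proof. by rewrite /sat_clause -all_predC. Qed.

Lemma unsat_assign a x b C :
  ~~ sat_clause (assign a x b) C =
  ~~ sat_clause a (dropv x C) && all (fun l => (l.1 == x) ==> (b != l.2)) C.
Proof.
rewrite !unsat_clauseE all_filter -all_predI; apply: eq_all => l /=.
by rewrite /assign; have [->|lx] := eqVneq l.1 x; rewrite /= ?andbT.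
Qed.

Lemma dropv_id x C : x \notin vars C -> dropv x C = C.
Proof.
move=> xC; apply/all_filterP/allP => l lC; apply: contraNneq xC => <-.
exact: map_f.
Qed.

Lemma sat_assign_notin a x b C : x \notin vars C ->
  sat_clause (assign a x b) C = sat_clause a C.
Proof.
move=> xC; apply: eq_in_has => l lC; rewrite /assign.
by have [lx|//] := eqVneq l.1 x; rewrite -lx map_f in xC.
Qed.

Lemma vars_dropv x C y : (y \in vars (dropv x C)) = (y != x) && (y \in vars C).
Proof.
apply/mapP/andP => [[l]|[yx /mapP[l lC yl]]].
  by rewrite mem_filter => /andP[lx lC] ->; split=> //; apply: map_f.
by exists l => //; rewrite mem_filter -yl yx.
Qed.

(** If [Ci] holds exactly one literal on [x], then for clauses over the variables of [Ci] the second
    test says that flipping the sign of [x] turns [C] into a subset of [Ci]. If [Ci] holds both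
    signs, no clause containing [x] passes it, so [keeps] is false, as it must be for a clause that
    is always satisfied. *)
Definition same_sign (Ci C : clause) : bool := all (fun l => l \in Ci) C.
Definition opposite_sign (x : nat) (Ci C : clause) : bool :=
  all (fun l : literal => if l.1 == x then l \notin Ci else l \in Ci) C.
Definition keeps (x : nat) (T : cnf) (Ci : clause) : bool :=
  count (same_sign Ci) T < count (opposite_sign x Ci) T.

(** Unless [a] already satisfies [Ci] off [x], it contradicts every literal of [Ci] off [x], hence
    is known on all variables of [T] except [x]. Whether a clause of [T] is falsified then depends
    only on the value of [x] and on how its signs compare with those of [Ci]. *)
Lemma peel_clause x T Ci a :
  x \in vars Ci -> (forall C, C \in T -> x \in vars C) ->
  (forall C, C \in T -> {subset vars C <= vars Ci}) ->
  minb x a (fun a' => falsified a' T + ~~ sat_clause a' Ci) =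
  minb x a (fun a' => falsified a' T) +
    (keeps x T Ci && ~~ sat_clause a (dropv x Ci)).
Proof.
move=> xCi xT sT.
have [satD|unsatD] := boolP (sat_clause a (dropv x Ci)).
  by rewrite andbF addn0 /minb !unsat_assign satD !addn0.
have memCi l : l \in Ci -> l.1 != x -> a l.1 != l.2.
  move=> lCi lx; move: unsatD; rewrite unsat_clauseE => /allP; apply.
  by rewrite mem_filter lx.
have lastE C b0 b : C \in T -> (x, b0) \in Ci -> (x, ~~ b0) \notin Ci ->
    ~~ sat_clause (assign a x b) C =
    if b == b0 then opposite_sign x Ci C else same_sign Ci C.
  move=> CT b0Ci nb0Ci; rewrite unsat_clauseE.
  have -> : (if b == b0 then opposite_sign x Ci C else same_sign Ci C) =
      all (fun l : literal => if (b == b0) && (l.1 == x) then l \notin Ci else l \in Ci) C.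
    by case: (b == b0).
  apply: eq_in_all => -[y c] lC; rewrite /assign /=.
  have [->|yx] := eqVneq y x.
    rewrite andbT; move: b0Ci nb0Ci; clear lC.
    by case: b; case: b0; case: c => /= h1 h2; rewrite ?h1 ?(negbTE h2).
  rewrite andbF; have /mapP[[y' c'] l'Ci /= yy'] : y \in vars Ci.
    by apply: (sT C) => //; apply/mapP; exists (y, c).
  subst y'; have := memCi _ l'Ci yx; move=> /= ac'.
  have [cc'|ncc'] := eqVneq c c'; first by rewrite cc' l'Ci.
  have ayc : (a y != c) = false by apply/negbTE; move: ac' ncc';
    clear; case: (a y); case: c; case: c'.
  by rewrite ayc; apply/esym/negP => lCi; have := memCi _ lCi yx; rewrite /= ayc.
have [l lCi lx] : exists2 l, l \in Ci & x = l.1 by apply/mapP.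
case: l lCi lx => y b0 b0Ci /= xy; subst y.
(* [Ci] contains both literals on [x]: it is never falsified, and no clause of [T] has opposite
   sign. *)
have [nb0Ci|nb0Ci] := boolP ((x, ~~ b0) \in Ci).
  have unsatCi b : ~~ sat_clause (assign a x b) Ci = false.
    apply/negbTE; rewrite negbK; apply/hasP.
    have [->|bb0] := eqVneq b b0; first by exists (x, b0) => //=; rewrite /assign eqxx.
    exists (x, ~~ b0) => //=; rewrite /assign eqxx.
    by move: bb0; clear; case: b b0 => -[].
  rewrite /minb !unsatCi !addn0; have -> // : keeps x T Ci = false.
    rewrite /keeps; have -> : count (opposite_sign x Ci) T = 0 by
      apply/eqP; rewrite -leqn0 leqNgt -has_count; apply/hasPn => C CT;
      have /mapP[[y c] lC /= xy] := xT _ CT; subst y;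
      apply/negP => /allP/(_ _ lC) /=; rewrite eqxx => /negP; apply;
      move: b0Ci nb0Ci; clear; case: c b0 => -[].
    by rewrite ltn0.
  by rewrite addn0.
rewrite !(minbE _ _ _ b0).
have fT b : falsified (assign a x b) T =
    if b == b0 then count (opposite_sign x Ci) T else count (same_sign Ci) T.
  have -> : (if b == b0 then count (opposite_sign x Ci) T else count (same_sign Ci) T)
     = count (fun C => if b == b0 then opposite_sign x Ci C else same_sign Ci C) T.
    by case: (b == b0).
  by apply: eq_in_count => C CT; apply: lastE.
have fCi b : ~~ sat_clause (assign a x b) Ci = (b != b0).
  rewrite unsat_assign unsatD /=; apply/allP/idP => [/(_ _ b0Ci)|bb0 [y c] lCi] /=.
    by rewrite eqxx.
  apply/implyP => /eqP yx; subst y.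
  by move: bb0 b0Ci nb0Ci lCi; clear; case: b; case: b0; case: c => // _ _ /negP // h /h.
rewrite !fT !fCi eqxx /=; have -> : (~~ b0 == b0) = false by clear; case: b0.
(* With [o] opposite and [s] same clauses, this is [min(o, s + 1) = min(o, s) + (s < o)]: the value
   [b0] satisfies [Ci] and the other one falsifies it. *)
by rewrite /keeps andbT; case: ltnP => /=; lia.
Qed.

Lemma num_satE a F : num_sat a F + falsified a F = size F.
Proof. exact: count_predC. Qed.

(** Equality of minima by mutual domination, which avoids taking a minimum over the infinite type of
    assignments. *)
Definition same_min (F G : cnf) : Prop :=
  (forall a, exists a', falsified a' G <= falsified a F) /\
  (forall a, exists a', falsified a' F <= falsified a G).

Lemma same_min_refl F : same_min F F.
Proof. by split=> a; exists a. Qed.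

Lemma same_min_trans F G H : same_min F G -> same_min G H -> same_min F H.
Proof.
move=> [FG GF] [GH HG]; split=> a.
  by have [a1 l1] := FG a; have [a2 l2] := GH a1; exists a2; apply: leq_trans l2 l1.
by have [a1 l1] := HG a; have [a2 l2] := GF a1; exists a2; apply: leq_trans l2 l1.
Qed.

(** Every assignment [a] is one of its own two variants at [x], so minimizing over [x] first does
    not change the global minimum. *)
Lemma same_min_minb x F G :
  (forall a, falsified a G = minb x a (falsified^~ F)) -> same_min F G.
Proof.
move=> FG; split=> a.
  exists a; rewrite FG (minbE _ _ _ (a x)).
  suff -> : falsified (assign a x (a x)) F = falsified a F by apply: geq_minl.
  apply: eq_count => C; congr (~~ _); apply: eq_has => l /=.
  by rewrite /assign; have [->|] := eqVneq l.1 x.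
rewrite FG /minb.
have [ge|lt] := leqP (falsified (assign a x false) F) (falsified (assign a x true) F).
  by exists (assign a x false).
by exists (assign a x true).
Qed.

(** Meant for a [G] without literals, where every assignment falsifies every clause. *)
Lemma same_min_value F G n :
  same_min F G -> (forall a, falsified a G = n) -> is_maxsat_value F (size F - n).
Proof.
move=> [FG GF] Gn; split; last first.
  by move=> a; have [a'] := FG a; rewrite Gn; have := num_satE a F; lia.
have [a] := GF (fun=> true); rewrite Gn => le; exists a.
by have [a'] := FG a; rewrite Gn; have := num_satE a F; lia.
Qed.

(** * Nest points and elimination orders *)

Definition nest (x : nat) (F : cnf) : Prop :=
  forall C1 C2, C1 \in F -> C2 \in F -> x \in vars C1 -> x \in vars C2 ->
    {subset vars C1 <= vars C2} \/ {subset vars C2 <= vars C1}.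

Definition cmp_off (s : seq nat) (C1 C2 : clause) : Prop :=
  forall y, y \notin s -> y \in vars C1 -> y \in vars C2.

(* [beta_elim_order] with all deletions performed at once: unlike the recursive
   form, it visibly survives deleting clauses and deleting a variable. *)
Definition elim_order (s : seq nat) (F : cnf) : Prop :=
  (forall C, C \in F -> {subset vars C <= s}) /\
  forall s1 x s2, s = s1 ++ x :: s2 -> x \notin s1 ->
    forall C1 C2, C1 \in F -> C2 \in F -> x \in vars C1 -> x \in vars C2 ->
      cmp_off s1 C1 C2 \/ cmp_off s1 C2 C1.

(** Deleting clauses, or one variable everywhere, can only weaken the comparisons, so the same [s]
    keeps serving. Entries of [s] that no longer occur do no harm; this is why the eliminated
    variable need not be the first of [s]. *)
Lemma elim_order_sub x s F G :
  (forall C, C \in G -> exists2 C', C' \in F &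
     forall y, (y \in vars C) = (y != x) && (y \in vars C')) ->
  elim_order s F -> elim_order s G.
Proof.
move=> FG [sF oF]; split.
  by move=> C /FG[C' C'F CC'] y; rewrite CC' => /andP[_]; apply: sF.
move=> s1 z s2 es zs1 C1 C2 /FG[C1' F1 e1] /FG[C2' F2 e2].
rewrite e1 e2 => /andP[zx z1] /andP[_ z2].
by case: (oF _ _ _ es zs1 _ _ F1 F2 z1 z2) => h; [left|right] => y ys1;
  rewrite e1 e2 => /andP[-> /h]; apply.
Qed.

(** The first entry of [s] that still occurs in [F] is a nest point: the entries before it occur in
    no clause, so comparing clauses off those entries is comparing them fully. *)
Lemma elim_order_nest s F C x : elim_order s F -> C \in F -> x \in vars C ->
  exists C' y, [/\ C' \in F, y \in vars C' & nest y F].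
Proof.
move=> [sF oF] CF xC.
pose p y := has (fun C => y \in vars C) F.
have hp : has p s.
  by apply/hasP; exists x; [apply: (sF C)|apply/hasP; exists C].
have pn := nth_find 0 hp; have lt := hp; rewrite has_find in lt.
have bef y : y \in take (find p s) s -> ~~ p y.
  move=> yt; have := yt; rewrite -index_mem size_take lt => lti.
  rewrite -(nth_index 0 yt) nth_take //.
  by apply/negbT; apply: before_find.
set z := nth 0 s _ in pn.
have es : s = take (find p s) s ++ z :: drop (find p s).+1 s.
  by rewrite -drop_nth // cat_take_drop.
have zs : z \notin take (find p s) s by apply/negP => /bef; rewrite pn.
have /hasP[C' C'F zC'] := pn.
exists C', z; split=> // C1 C2 F1 F2 z1 z2.
by case: (oF _ _ _ es zs _ _ F1 F2 z1 z2) => h; [left|right] => y yC; apply: h => //;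
  apply/negP => /bef/negP; apply; apply/hasP; [exists C1|exists C2].
Qed.

Local Open Scope fset_scope.

Lemma beta_elim_order_cmp s H : beta_elim_order H s ->
  (forall y, y \in hV H -> y \in s) /\
  forall s1 x s2, s = s1 ++ x :: s2 -> x \notin s1 ->
    forall e1 e2, e1 \in hE H -> e2 \in hE H -> x \in e1 -> x \in e2 ->
      (forall y, y \notin s1 -> y \in e1 -> y \in e2) \/
      (forall y, y \notin s1 -> y \in e2 -> y \in e1).
Proof.
elim: s H => [|z s IH] H /=.
  by move=> ->; split=> [y|[]] //; rewrite in_fset0.
move=> [zH [nz /IH[sV sE]]]; split.
  move=> y yH; rewrite inE; have [//|yz] := eqVneq y z.
  by apply: sV; rewrite !inE yz.
case=> [|z' s1] x s2 /= [].
  move=> zx _ _ e1 e2 h1 h2 x1 x2; subst z.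
  by case/orP: (nz _ _ h1 h2 x1 x2) => /fsubsetP h; [left|right] => y _; apply: h.
move=> <- es; rewrite inE negb_or => /andP[xz xs1] e1 e2 h1 h2 x1 x2.
(* An edge containing [x] does not become empty when [z] is removed, so it is not discarded by
   [hdel]. *)
have del e : e \in hE H -> x \in e -> e `\` [fset z] \in hE (hdel H [fset z]).
  move=> he xe; rewrite !inE; apply/andP; split; last first.
    by apply/imfsetP; exists e.
  by apply/eqP => /fsetP/(_ x); rewrite !inE xz xe.
have mem e : x \in e -> x \in e `\` [fset z] by rewrite !inE xz.
by case: (sE _ _ _ es xs1 _ _ (del _ h1 x1) (del _ h2 x2) (mem _ x1) (mem _ x2)) => h;
  [left|right] => y; rewrite inE negb_or => /andP[yz ys1] ye;
  have := h y ys1; rewrite !inE yz ye; apply.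
Qed.

Lemma beta_acyclic_elim_order F :
  beta_acyclic (hyp_of_cnf F) -> exists s, elim_order s F.
Proof.
move=> [s /beta_elim_order_cmp[sV sE]]; exists s.
have vE C y : (y \in var_clause C) = (y \in vars C).
  apply/imfsetP/mapP => -[l lC ->]; by exists l.
split=> [C CF y yC|s1 x s2 es xs1 C1 C2 F1 F2 x1 x2].
  apply: sV; apply/bigfcupP; exists C; rewrite ?CF ?andbT // vE //.
have hE' C : C \in F -> var_clause C \in hE (hyp_of_cnf F).
  by move=> CF; apply/imfsetP; exists C.
rewrite -!vE in x1 x2.
by case: (sE _ _ _ es xs1 _ _ (hE' _ F1) (hE' _ F2) x1 x2) => h; [left|right] => y;
  have := h y; rewrite !vE.
Qed.

Local Close Scope fset_scope.

(** * Finite-state passes over a word, and a Turing machine iterating them *)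

Section Scan.
Variables (Q A : Type) (f : Q -> A -> Q * A).

Fixpoint scan (q : Q) (s : seq A) : Q * seq A :=
  if s is x :: s' then
    let r := scan (f q x).1 s' in (r.1, (f q x).2 :: r.2)
  else (q, [::]).

Fixpoint scanr (q : Q) (s : seq A) : Q * seq A :=
  if s is x :: s' then
    let r := scanr q s' in ((f r.1 x).1, (f r.1 x).2 :: r.2)
  else (q, [::]).

Lemma scan_cat q s1 s2 : scan q (s1 ++ s2) =
  ((scan (scan q s1).1 s2).1, (scan q s1).2 ++ (scan (scan q s1).1 s2).2).
Proof.
elim: s1 q => [|x s1 IH] q /=; first by case: (scan q s2).
by rewrite IH.
Qed.

Lemma scanr_cat q s1 s2 : scanr q (s1 ++ s2) =
  ((scanr (scanr q s2).1 s1).1, (scanr (scanr q s2).1 s1).2 ++ (scanr q s2).2).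
Proof.
elim: s1 q => [|x s1 IH] q /=; first by case: (scanr q s2).
by rewrite IH.
Qed.

Lemma size_scan q s : size (scan q s).2 = size s.
Proof. by elim: s q => //= x s IH q; rewrite IH. Qed.

Lemma size_scanr q s : size (scanr q s).2 = size s.
Proof. by elim: s q => //= x s IH q; rewrite IH. Qed.

End Scan.

(* A round rewrites the whole tape by one left-to-right finite-state
   pass followed by one right-to-left pass, and then moves to a new label. *)
Section RoundMachine.
Variables (lab cell Q : finType) (fw bw : lab -> Q -> cell -> Q * cell).
Variables (q0 : Q) (nxt : lab -> Q -> lab) (start halt : lab) (symc : Sym -> cell).
Hypothesis symc_inj :
  forall s t, s <> S_blank -> t <> S_blank -> symc s = symc t -> s = t.
Hypothesis start_halt : start != halt.

Definition round (c : lab * seq cell) : lab * seq cell :=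
  let r1 := scan (fw c.1) q0 c.2 in
  let r2 := scanr (bw c.1) r1.1 r1.2 in (nxt c.1 r2.1, r2.2).

Fixpoint rounds (n : nat) (c c' : lab * seq cell) : Prop :=
  if n is n'.+1 then c.1 != halt /\ rounds n' (round c) c' else c = c'.

Lemma rounds_trans m n c1 c2 c3 :
  rounds m c1 c2 -> rounds n c2 c3 -> rounds (m + n) c1 c3.
Proof. by elim: m c1 => [|m IH] c1 /=; [move=> ->|move=> [-> /IH h] /h]. Qed.

Lemma size_round c : size (round c).2 = size c.2.
Proof. by rewrite /round /= size_scanr size_scan. Qed.

(** The blank is [None], distinct from all cells, so that a pass recognizes both ends of the
    word. *)
Definition tsym (s : Sym) : option cell := if s is S_blank then None else Some (symc s).

Lemma tsym_inj : injective tsym.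
Proof.
move=> s t; have [] : (s = S_blank) \/ (s <> S_blank) by case: s; [left|right..].
  by move=> ->; case: t.
have [] : (t = S_blank) \/ (t <> S_blank) by case: t; [left|right..].
  by move=> ->; case: s.
move=> ht hs; have -> : tsym s = Some (symc s) by case: s hs.
have -> : tsym t = Some (symc t) by case: t ht.
by move=> [] /symc_inj; apply.
Qed.

Definition rm_state : finType := (lab * Q * bool + bool)%type.

(* [inl (l, q, false)] and [inl (l, q, true)] run the forward and backward passes of
   label [l]; [inr false] strips the leading zeros of the result; [inr true] halts. *)
Definition rm_delta (q : rm_state) (a : option cell) : rm_state * option cell * Move :=
  match q with
  | inl (l, q, false) =>
      if a is Some x then (inl (l, (fw l q x).1, false), Some (fw l q x).2, MoveR)
      else (inl (l, q, true), None, MoveL)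
  | inl (l, q, true) =>
      if a is Some x then (inl (l, (bw l q x).1, true), Some (bw l q x).2, MoveL)
      else if nxt l q == halt then (inr false, None, MoveR)
      else (inl (nxt l q, q0, false), None, MoveR)
  | inr false =>
      if a is Some x then
        if x == symc S_0 then (inr false, a, MoveR) else (inr true, a, MoveN)
      else (inr true, Some (symc S_0), MoveN)
  | inr true => (q, a, MoveN)
  end.

Definition rm_tm : TM := {|
  tm_state := rm_state;
  tm_gam := option cell;
  tm_sym := tsym;
  tm_sym_inj := tsym_inj;
  tm_start := inl (start, q0, false);
  tm_halt := fun q => if q is inr true then true else false;
  tm_delta := rm_delta |}.

(** The scanned cell is the head of the right word, resp. of the left word, a blank being supplied
    when that word is empty. This absorbs the case distinctions of [tm_step] at the ends of the
    tape. *)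
Definition rconf (q : rm_state) (l s : seq (option cell)) : config rm_tm :=
  if s is a :: r then (q, l, a, r) else (q, l, None, [::]).
Definition lconf (q : rm_state) (l r : seq (option cell)) : config rm_tm :=
  if l is a :: l' then (q, l', a, r) else (q, [::], None, r).

(** What lies beyond the word on either side: nothing before the first visit, one blank afterwards.
    The tape does not grow with the number of rounds. *)
Definition padding (s : seq (option cell)) : Prop := s = [::] \/ s = [:: None].

Lemma run_forward l q t L p :
  tm_run (size t) (rconf (inl (l, q, false)) L (map Some t ++ p)) =
  rconf (inl (l, (scan (fw l) q t).1, false))
        (rev (map Some (scan (fw l) q t).2) ++ L) p.
Proof.
elim: t q L => [|x t IH] q L //; rewrite /tm_run iterSr.
have -> : tm_step (rconf (inl (l, q, false)) L (map Some (x :: t) ++ p)) =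
    rconf (inl (l, (fw l q x).1, false)) (Some (fw l q x).2 :: L) (map Some t ++ p).
  by rewrite /=; case: (map Some t ++ p).
by have := IH (fw l q x).1 (Some (fw l q x).2 :: L);
  rewrite /tm_run => -> /=; rewrite rev_cons cat_rcons.
Qed.

Lemma run_backward l q t L p :
  tm_run (size t) (lconf (inl (l, q, true)) (rev (map Some t) ++ L) p) =
  lconf (inl (l, (scanr (bw l) q t).1, true)) L
        (map Some (scanr (bw l) q t).2 ++ p).
Proof.
elim: t q L => [|x t IH] q L //.
rewrite map_cons rev_cons cat_rcons /tm_run /= .
have := IH q (Some x :: L); rewrite /tm_run => -> /=.
by case: L.
Qed.

Definition rm_conf (c : lab * seq cell) (L p : seq (option cell)) : config rm_tm :=
  rconf (if c.1 == halt then inr false else inl (c.1, q0, false)) L (map Some c.2 ++ p).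

Lemma run_round c L p : c.1 != halt -> padding L -> padding p ->
  tm_run ((size c.2).*2 + 2) (rm_conf c L p) = rm_conf (round c) [:: None] [:: None].
Proof.
case: c => l t; rewrite /rm_conf /= => /negbTE-> pL pp.
(* One step per cell in each direction, and one to turn round at the blank on each end. *)
have -> : (size t).*2 + 2 = 1 + (size t + (1 + size t)) by lia.
rewrite /tm_run !iterD; have := run_forward l q0 t L p; rewrite /tm_run => ->.
set r1 := scan _ _ _.
have -> : iter 1 (@tm_step rm_tm) (rconf (inl (l, r1.1, false)) (rev (map Some r1.2) ++ L) p)
   = lconf (inl (l, r1.1, true)) (rev (map Some r1.2) ++ L) [:: None].
  by case: pp => ->; rewrite /=; case: (rev _ ++ L).
have := run_backward l r1.1 r1.2 L [:: None]; rewrite /tm_run size_scan => ->.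
rewrite /round /= -/r1; set r2 := scanr _ _ _.
by case: pL => -> /=; case: ifP => _ /=; case: (map Some r2.2 ++ [:: None]).
Qed.

Lemma run_rounds n c c' L p : rounds n c c' -> padding L -> padding p ->
  exists L' p', [/\ padding L', padding p' &
    tm_run (n * ((size c.2).*2 + 2)) (rm_conf c L p) = rm_conf c' L' p'].
Proof.
elim: n c L p => [|n IH] c L p /=; first by move=> <- pL pp; exists L, p.
move=> [ch /IH h] pL pp; have [L' [p' [pL' pp' e]]] : exists L' p', [/\ padding L', padding p' &
    tm_run (n * ((size (round c).2).*2 + 2)) (rm_conf (round c) [:: None] [:: None]) = rm_conf c' L' p'].
  by apply: h; right.
exists L', p'; split=> //; rewrite mulSn addnC /tm_run iterD.
by have := run_round ch pL pp; rewrite /tm_run => ->; rewrite -e size_round.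
Qed.

(** A word of zeros becomes a single zero, which is how [nat_bits] writes 0. *)
Fixpoint strip_zeros (s : seq cell) : seq cell :=
  if s is x :: s' then if x == symc S_0 then strip_zeros s' else s else [:: symc S_0].

Lemma upto_blank_some (t : seq cell) p : padding p ->
  @upto_blank rm_tm (map Some t ++ p) = map Some t.
Proof.
by move=> pp; elim: t => [|x t /= ->] //; case: pp => ->.
Qed.

(** The output is read from the head onwards, so leading zeros are dropped by walking over them. If
    nothing else follows, the machine writes a zero on the blank behind the word. *)
Lemma run_strip t L p : padding p -> exists2 k, k <= (size t).+1 &
  halted (tm_run k (rconf (inr false) L (map Some t ++ p))) /\
  tm_output (tm_run k (rconf (inr false) L (map Some t ++ p))) = map Some (strip_zeros t).
Proof.
move=> pp; elim: t L => [|x t IH] L.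
  exists 1 => //; case: pp => ->; split=> //=.
rewrite /=; case: eqP => [->|] /=; last first.
  move=> /eqP/negbTE x0; exists 1 => //; rewrite /tm_run /= x0 /=; split=> //.
  by rewrite upto_blank_some.
have [k kt h] := IH (Some (symc S_0) :: L); exists k.+1 => //.
rewrite /tm_run iterSr /= eqxx.
by move: h; rewrite /tm_run /rconf; case: (map Some t ++ p).
Qed.

Theorem rm_computes n w t : (forall s, List.In s w -> s <> S_blank) ->
  rounds n (start, map symc w) (halt, t) ->
  exists2 k, k <= n * ((size w).*2 + 2) + (size t).+1 &
    halted (tm_run k (tm_init rm_tm w)) /\
    tm_output (tm_run k (tm_init rm_tm w)) = map Some (strip_zeros t).
Proof.
move=> wb rt.
have -> : tm_init rm_tm w = rm_conf (start, map symc w) [::] [::].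
  rewrite /rm_conf /= (negbTE start_halt) cats0.
  have tE u : (forall s, List.In s u -> s <> S_blank) ->
      map tsym u = map Some (map symc u).
    elim: u => //= s u IHu ub; rewrite IHu; last by move=> s' us'; apply: ub; right.
    by have := ub s (or_introl erefl); case: s {ub}.
  by have := tE _ wb; case: w {wb rt tE} => //= s w [-> ->].
have [L [p [_ pp e]]] := run_rounds rt (or_introl erefl) (or_introl erefl).
rewrite /= size_map in e.
have [k kt h] := run_strip t L pp.
exists (k + n * ((size w).*2 + 2)); first by rewrite addnC leq_add2l.
by rewrite /tm_run iterD; rewrite /tm_run in e; rewrite e /rm_conf /= eqxx.
Qed.

End RoundMachine.

(** * Alphabet, labels and passes of the machine *)

(* Flags of a literal: deleted; tried as elimination variable; source of the current
   name comparison; result of that comparison; carries the elimination variable;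
   variable, resp. literal, of the current clause; still to be compared. *)
Record lflags := LF { fD : bool; fT : bool; fP : bool; fE : bool;
                      fX : bool; fV : bool; fL : bool; fN : bool }.

(* Flags of a clause: deleted; tried as largest clause; current; contains the elimination
   variable and is not yet peeled; to be counted as [same_sign], resp. [opposite_sign];
   to be deleted when the elimination is carried out. *)
Record cflags := CF { gD : bool; gT : bool; gC : bool; gI : bool;
                      gS : bool; gO : bool; gK : bool }.

(* [CBit b k] is a bit of a variable name, [k] telling that the current comparison has
   already read it; [COut m b] is a cell of the final counting phase, where [m] marks a
   clause to be counted and [b] is a bit of the counter. *)
Inductive cell :=
  | CLit of bool & lflags | CEnd of cflags | CBit of bool & bool | COut of bool & bool.

(** The Boolean of [Match] and [MatchEnd] is the purpose of the name comparison: [false] to find the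
    occurrences of a new elimination variable, [true] to find the occurrences of a literal of the
    current clause. *)
Inductive label := PickVar | Match of bool | MatchEnd of bool | PickClause | PickLit
  | Check | Count | Commit | Fin0 | Fin | Out | Halt.

Definition lflags_tuple f :=
  let: LF d t p e x v l n := f in (d, t, p, e, (x, v, l, n)).
Definition tuple_lflags u :=
  let: (d, t, p, e, (x, v, l, n)) := u in LF d t p e x v l n.
Lemma lflags_tupleK : cancel lflags_tuple tuple_lflags. Proof. by case. Qed.
HB.instance Definition _ := Finite.copy lflags (can_type lflags_tupleK).

Definition cflags_tuple f :=
  let: CF d t c i s o k := f in (d, t, c, i, (s, o, k)).
Definition tuple_cflags u :=
  let: (d, t, c, i, (s, o, k)) := u in CF d t c i s o k.
Lemma cflags_tupleK : cancel cflags_tuple tuple_cflags. Proof. by case. Qed.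
HB.instance Definition _ := Finite.copy cflags (can_type cflags_tupleK).

Definition cell_sum (c : cell) : (bool * lflags) + cflags + (bool * bool) + (bool * bool) :=
  match c with
  | CLit s f => inl (inl (inl (s, f)))
  | CEnd f => inl (inl (inr f))
  | CBit b k => inl (inr (b, k))
  | COut m b => inr (m, b)
  end.
Definition sum_cell c :=
  match c with
  | inl (inl (inl (s, f))) => CLit s f
  | inl (inl (inr f)) => CEnd f
  | inl (inr (b, k)) => CBit b k
  | inr (m, b) => COut m b
  end.
Lemma cell_sumK : cancel cell_sum sum_cell. Proof. by case. Qed.
HB.instance Definition _ := Finite.copy cell (can_type cell_sumK).

Definition label_ord (l : label) : 'I_14 :=
  inord (match l with
    | PickVar => 0 | Match b => 1 + b | MatchEnd b => 3 + b | PickClause => 5 | PickLit => 6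
    | Check => 7 | Count => 8 | Commit => 9 | Fin0 => 10 | Fin => 11 | Out => 12
    | Halt => 13 end).
Definition ord_label (i : 'I_14) : label :=
  nth Halt [:: PickVar; Match false; Match true; MatchEnd false; MatchEnd true; PickClause;
    PickLit; Check; Count; Commit; Fin0; Fin; Out; Halt] i.
Lemma label_ordK : cancel label_ord ord_label.
Proof. by case=> [|[]|[]|||||||||]; rewrite /ord_label inordK. Qed.
HB.instance Definition _ := Finite.copy label (can_type label_ordK).

(** Four bits whose meaning depends on the pass, and two optional bits for name comparison: [mo1] is
    the digit of the source name, [mo2] the digit of the name being scanned. *)
Definition mstate : finType :=
  (bool * bool * bool * bool * option bool * option bool)%type.
Definition bst (b1 b2 b3 b4 : bool) : mstate := (b1, b2, b3, b4, None, None).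
Definition ms0 : mstate := bst false false false false.
Definition mst (b : bool) (o1 o2 : option bool) : mstate :=
  (b, false, false, false, o1, o2).
Definition ms1 (q : mstate) := q.1.1.1.1.1.
Definition ms2 (q : mstate) := q.1.1.1.1.2.
Definition ms3 (q : mstate) := q.1.1.1.2.
Definition ms4 (q : mstate) := q.1.1.2.
Definition mo1 (q : mstate) := q.1.2.
Definition mo2 (q : mstate) := q.2.

Definition lit_pass := mstate -> bool -> lflags -> mstate * lflags.
Definition end_pass := mstate -> cflags -> mstate * cflags.

(** Every ordinary pass also marks all name bits as unread, so each comparison starts afresh. *)
Definition pass (tl : lit_pass) (te : end_pass) (q : mstate) (c : cell) : mstate * cell :=
  match c with
  | CLit s f => ((tl q s f).1, CLit s (tl q s f).2)
  | CEnd f => ((te q f).1, CEnd (te q f).2)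
  | CBit b _ => (q, CBit b false)
  | COut _ _ => (q, c)
  end.

Definition lit_id : lit_pass := fun q _ f => (q, f).
Definition end_id : end_pass := fun q f => (q, f).
Definition pass_id := pass lit_id end_id.

(** Besides choosing the first literal satisfying [p] as source, this sets [fE] everywhere: before
    any digit is read, all names agree. *)
Definition lit_pick (p : pred lflags) : lit_pass := fun q _ f =>
  let h := ~~ ms1 q && p f in
  (bst (ms1 q || h) false false false,
   LF (fD f) (fT f) h true (fX f) (fV f) (fL f) (fN f)).
Definition untried (f : lflags) := ~~ fD f && ~~ fT f.

(* Reads the last unread bit of the name of the source literal. *)
Definition match_fw (q : mstate) (c : cell) : mstate * cell :=
  match c with
  | CLit _ f => (mst (fP f) (mo1 q) None, c)
  | CEnd _ => (mst false (mo1 q) None, c)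
  | CBit b k =>
      (mst (ms1 q) (if ms1 q && ~~ k then Some b else mo1 q) None, c)
  | COut _ _ => (q, c)
  end.

(* Reads the last unread bit of every name and compares it with the one of the source. *)
Definition match_bw (q : mstate) (c : cell) : mstate * cell :=
  match c with
  | CLit s f => (mst false (mo1 q) None,
      CLit s (LF (fD f) (fT f) (fP f) (fE f && (mo2 q == mo1 q))
                 (fX f) (fV f) (fL f) (fN f)))
  | CEnd _ => (mst false (mo1 q) None, c)
  | CBit b k =>
      if k || isSome (mo2 q) then (q, c)
      else (mst false (mo1 q) (Some b), CBit b true)
  | COut _ _ => (q, c)
  end.

(** The end cell follows its literals, so a forward pass can tell it whether a live occurrence of
    the variable was seen. All occurrences count as tried at once. *)
Definition lit_variable : lit_pass := fun q _ f =>
  (bst (ms1 q || (~~ fD f && fE f)) false false false,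
   LF (fD f) (fT f || fE f) false false (fE f) (fV f) (fL f) (fN f)).
Definition end_variable : end_pass := fun q f =>
  (ms0, CF (gD f) false false (ms1 q) (gS f) (gO f) false).

Definition end_pick : end_pass := fun q f =>
  let h := ~~ ms1 q && (gI f && ~~ gT f) in
  (bst (ms1 q || h) (ms2 q || gI f) false false,
   CF (gD f) (gT f || h) h (gI f) (gS f) (gO f) (gK f)).
(** Used backwards, so that the literals learn from the end cell whether their clause is the current
    one. *)
Definition lit_current : lit_pass := fun q _ f =>
  (q, LF (fD f) (fT f) (fP f) (fE f) (fX f) false false (ms3 q && ~~ fD f)).
Definition end_current : end_pass := fun q f => (bst (ms1 q) (ms2 q) (gC f) false, f).

Definition lit_source : lit_pass := fun q s f =>
  (bst (if fP f then s else ms1 q) false false false, f).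
Definition lit_mark : lit_pass := fun q s f =>
  let m := fE f && (s == ms1 q) in
  (q, LF (fD f) (fT f) false false (fX f) (fV f || fE f) (fL f || m) (fN f && ~~ m)).

(** Within a clause, [ms2], [ms3] and [ms4] record a live literal violating coverage, [same_sign]
    and [opposite_sign] with respect to the current clause; [ms1] records across clauses that some
    unpeeled one is not covered. *)
Definition lit_check : lit_pass := fun q _ f =>
  (if fD f then q else
   bst (ms1 q) (ms2 q || ~~ fV f) (ms3 q || ~~ fL f)
       (ms4 q || (if fX f then fL f else ~~ fL f)),
   LF (fD f) (fT f) false false (fX f) (fV f) (fL f) (fN f)).
Definition end_check : end_pass := fun q f =>
  (bst (ms1 q || (gI f && ms2 q)) false false false,
   CF (gD f) (gT f) (gC f) (gI f) (gI f && ~~ gC f && ~~ ms3 q)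
      (gI f && ~~ gC f && ~~ ms4 q) (gK f)).

(** The forward pass removes the first flag of each kind and remembers whether there was one. If a
    kind was missing, the comparison is settled: the opposite clauses are more numerous exactly if
    only they were found, that is, if [ms2] holds. *)
Definition end_count : end_pass := fun q f =>
  (bst (ms1 q || gS f) (ms2 q || gO f) false false,
   CF (gD f) (gT f) (gC f) (gI f) (ms1 q && gS f) (ms2 q && gO f) (gK f)).
Definition end_decide : end_pass := fun q f =>
  (q, if ms1 q && ms2 q then f else
      CF (gD f) false false (gI f && ~~ gC f) false false
         (if gC f then ~~ ms2 q else gK f)).

(** Used backwards, so that the literals of a deleted clause are deleted too. The flag [fT] is reset
    because removing a variable can create new nest points. *)
Definition lit_commit : lit_pass := fun q _ f =>
  (q, LF (fD f || fX f || ms1 q) false (fP f) (fE f) (fX f) (fV f) (fL f) (fN f)).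
Definition end_commit : end_pass := fun q f =>
  (bst (gD f || gK f) false false false,
   CF (gD f || gK f) (gT f) (gC f) (gI f) (gS f) (gO f) (gK f)).

(** The whole tape becomes a binary counter with marks on it. Each later round erases the first mark
    going right and, if there was one, adds 1 to the counter going left, [ms2] being the carry. *)
Definition fin0_fw (q : mstate) (c : cell) : mstate * cell :=
  (q, COut (if c is CEnd f then gD f else false) false).
Definition fin_fw (q : mstate) (c : cell) : mstate * cell :=
  if c is COut m b then (bst (ms1 q || m) (ms1 q || m) false false, COut (ms1 q && m) b)
  else (q, c).
Definition fin_bw (q : mstate) (c : cell) : mstate * cell :=
  if c is COut m b then (bst (ms1 q) (ms2 q && b) false false, COut m (ms2 q (+) b))
  else (q, c).
Definition out_fw (q : mstate) (c : cell) : mstate * cell :=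
  if c is COut m b then (q, CBit b false) else (q, c).

Definition mfw (l : label) : mstate -> cell -> mstate * cell :=
  match l with
  | PickVar => pass (lit_pick untried) end_id
  | Match _ => match_fw
  | MatchEnd false => pass lit_variable end_variable
  | MatchEnd true => pass lit_source end_id
  | PickClause => pass lit_id end_pick
  | PickLit => pass (lit_pick fN) end_id
  | Check => pass lit_check end_check
  | Count => pass lit_id end_count
  | Fin0 => fin0_fw
  | Fin => fin_fw
  | Out => out_fw
  | _ => pass_id
  end.

Definition mbw (l : label) : mstate -> cell -> mstate * cell :=
  match l with
  | Match _ => match_bw
  | MatchEnd true => pass lit_mark end_id
  | PickClause => pass lit_current end_current
  | Count => pass lit_id end_decide
  | Commit => pass lit_commit end_commit
  | Fin => fin_bw
  | _ => pass_id
  end.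

Definition mnext (l : label) (q : mstate) : label :=
  match l with
  | PickVar => if ms1 q then Match false else Fin0
  | Match r => if mo1 q then Match r else MatchEnd r
  | MatchEnd false => PickClause
  | MatchEnd true => PickLit
  (* Without a candidate, either an unpeeled clause remains and the variable is abandoned, or all
     are peeled and the elimination is carried out. *)
  | PickClause => if ms1 q then PickLit else if ms2 q then PickVar else Commit
  | PickLit => if ms1 q then Match true else Check
  | Check => if ms1 q then PickClause else Count
  | Count => if ms1 q && ms2 q then Count else PickClause
  | Commit => PickVar
  | Fin0 => Fin
  | Fin => if ms1 q then Fin else Out
  | Out | Halt => Halt
  end.

(** * Binary numerals, and the tape as an encoded configuration *)

Fixpoint pbits (p : BinNums.positive) : seq bool :=
  match p with
  | BinNums.xH => [:: true]
  | BinNums.xO p' => rcons (pbits p') false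
  | BinNums.xI p' => rcons (pbits p') true
  end.

Definition nbits (n : nat) : seq bool :=
  match bin_of_nat n with
  | BinNums.N0 => [:: false]
  | BinNums.Npos p => pbits p
  end.

Definition bit_sym (b : bool) : Sym := if b then S_1 else S_0.

Lemma nat_bitsE n : nat_bits n = map bit_sym (nbits n).
Proof.
rewrite /nat_bits /nbits; case: (bin_of_nat n) => [|p] //.
by elim: p => [p /= ->|p /= ->|] //=; rewrite map_rcons.
Qed.

Definition bits_val (s : seq bool) : nat := foldl (fun (v : nat) (b : bool) => v.*2 + b) 0 s.

Lemma bits_val_rcons s b : bits_val (rcons s b) = (bits_val s).*2 + b.
Proof. by rewrite /bits_val -cats1 foldl_cat. Qed.

Lemma bits_val_cons b s : bits_val (b :: s) = b * 2 ^ size s + bits_val s.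
Proof.
elim/last_ind: s => [|s c IH]; first by rewrite muln1 addn0.
by rewrite -rcons_cons !bits_val_rcons IH size_rcons expnS; lia.
Qed.

Lemma bits_val_lt s : bits_val s < 2 ^ size s.
Proof. by elim/last_ind: s => // s b IH; rewrite bits_val_rcons size_rcons expnS; lia. Qed.

Lemma nbitsK : cancel nbits bits_val.
Proof.
move=> n; rewrite -[RHS]bin_of_natK /nbits; case: (bin_of_nat n) => [|p] //=.
by elim: p => [p IH|p IH|] //=; rewrite bits_val_rcons IH ?NatTrec.doubleE; lia.
Qed.

Lemma nbits_head n : 0 < n -> exists s, nbits n = true :: s.
Proof.
move=> n0; have : nat_of_bin (bin_of_nat n) != 0 by rewrite bin_of_natK -lt0n.
rewrite /nbits; case: (bin_of_nat n) => [|p] // _.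
by elim: p => [p [s /= ->]|p [s /= ->]|]; [exists (rcons s true)|exists (rcons s false)|exists [::]].
Qed.

Lemma bits_val_inj s t : size s = size t -> bits_val s = bits_val t -> s = t.
Proof.
elim/last_ind: s t => [|s b IH] t; case/lastP: t => [|t c] //; rewrite ?size_rcons //.
by move=> [] /IH h; rewrite !bits_val_rcons => e; congr rcons; [apply: h; lia|
  move: e; case: b; case: c; lia].
Qed.

(* A literal or clause together with its flags; the tape [enc i st] holds the
   configuration [st] with the last [i] bits of every name read. *)
Definition alit := (literal * lflags)%type.
Definition aclause := (seq alit * cflags)%type.

Definition enc_bits (i : nat) (s : seq bool) : seq cell :=
  [seq CBit b false | b <- take (size s - i) s] ++
  [seq CBit b true | b <- drop (size s - i) s].
Definition enc_alit (i : nat) (l : alit) : seq cell :=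
  CLit l.1.2 l.2 :: enc_bits i (nbits l.1.1).
Definition enc_aclause (i : nat) (c : aclause) : seq cell :=
  flatten (map (enc_alit i) c.1) ++ [:: CEnd c.2].
Definition enc (i : nat) (st : seq aclause) : seq cell :=
  flatten (map (enc_aclause i) st).

Definition alit_pass (tl : lit_pass) (q : mstate) (l : alit) : mstate * alit :=
  ((tl q l.1.2 l.2).1, (l.1, (tl q l.1.2 l.2).2)).
Definition aclause_pass (tl : lit_pass) (te : end_pass) (q : mstate) (c : aclause) :
    mstate * aclause :=
  let r := scan (alit_pass tl) q c.1 in
  ((te r.1 c.2).1, (r.2, (te r.1 c.2).2)).
Definition aclause_passr (tl : lit_pass) (te : end_pass) (q : mstate) (c : aclause) :
    mstate * aclause :=
  let r := scanr (alit_pass tl) (te q c.2).1 c.1 in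
  (r.1, (r.2, (te q c.2).2)).

Lemma scan_pass_bits tl te q i s :
  scan (pass tl te) q (enc_bits i s) = (q, enc_bits 0 s).
Proof.
have sc k t : scan (pass tl te) q [seq CBit b k | b <- t] = (q, [seq CBit b false | b <- t]).
  by elim: t => //= b t ->.
by rewrite /enc_bits scan_cat !sc /= -map_cat cat_take_drop subn0 take_size drop_size cats0.
Qed.

Lemma scanr_pass_bits tl te q i s :
  scanr (pass tl te) q (enc_bits i s) = (q, enc_bits 0 s).
Proof.
have sc k t : scanr (pass tl te) q [seq CBit b k | b <- t] = (q, [seq CBit b false | b <- t]).
  by elim: t => //= b t ->.
by rewrite /enc_bits scanr_cat !sc /= -map_cat cat_take_drop subn0 take_size drop_size cats0.
Qed.

Lemma scan_enc tl te q i st : scan (pass tl te) q (enc i st) =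
  ((scan (aclause_pass tl te) q st).1, enc 0 (scan (aclause_pass tl te) q st).2).
Proof.
have lits ls q' : scan (pass tl te) q' (flatten (map (enc_alit i) ls)) =
   ((scan (alit_pass tl) q' ls).1, flatten (map (enc_alit 0) (scan (alit_pass tl) q' ls).2)).
  elim: ls q' => //= l ls IH q'.
  by rewrite scan_cat scan_pass_bits IH.
elim: st q => //= c st IH q; rewrite /enc /= scan_cat.
by rewrite {1 3 5}/enc_aclause scan_cat lits /= -/(enc i st) IH.
Qed.

Lemma scanr_enc tl te q i st : scanr (pass tl te) q (enc i st) =
  ((scanr (aclause_passr tl te) q st).1, enc 0 (scanr (aclause_passr tl te) q st).2).
Proof.
have lits ls q' : scanr (pass tl te) q' (flatten (map (enc_alit i) ls)) =
   ((scanr (alit_pass tl) q' ls).1, flatten (map (enc_alit 0) (scanr (alit_pass tl) q' ls).2)).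
  elim: ls q' => //= l ls IH q'.
  by rewrite scanr_cat scanr_pass_bits IH.
elim: st q => //= c st IH q; rewrite /enc /= scanr_cat -/(enc i st) IH.
by rewrite {1 3}/enc_aclause scanr_cat lits.
Qed.

Notation mround := (round mfw mbw ms0 mnext).
Notation mrounds := (rounds mfw mbw ms0 mnext Halt).

Lemma round_pass l tl te tl' te' i st :
  mfw l = pass tl te -> mbw l = pass tl' te' ->
  mround (l, enc i st) =
    (mnext l (scanr (aclause_passr tl' te') (scan (aclause_pass tl te) ms0 st).1
                (scan (aclause_pass tl te) ms0 st).2).1,
     enc 0 (scanr (aclause_passr tl' te') (scan (aclause_pass tl te) ms0 st).1
              (scan (aclause_pass tl te) ms0 st).2).2).
Proof. by move=> e1 e2; rewrite /round /= e1 e2 scan_enc scanr_enc. Qed.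

(** * Comparing variable names *)

Definition digit (i : nat) (s : seq bool) : option bool := onth (rev s) i.

Lemma digitE i s : digit i s = ohead (rev (take (size s - i) s)).
Proof.
rewrite rev_take /digit; have [le|lt] := leqP i (size s).
  rewrite subKn //; elim: (rev s) i {le} => [|b t IH] [|i] //=.
have -> : size s - i = 0 by lia.
by rewrite subn0 drop_oversize ?size_rev // onth_default // size_rev ltnW.
Qed.

(** The index [size s], where [s] has no digit, is included: it excludes that [t] is longer. *)
Lemma digit_inj s t : (forall i, i <= size s -> digit i s = digit i t) -> s = t.
Proof.
move=> h; apply: (can_inj revK).
have : forall i, i <= size (rev s) -> onth (rev s) i = onth (rev t) i.
  by move=> i; rewrite size_rev; apply: h.
elim: (rev s) (rev t) => [|b u IH] [|c v] //= e; try by have := e 0 isT.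
have [->] := e 0 isT; congr cons; apply: IH => i ui; exact: (e i.+1 ui).
Qed.

Lemma scan_match_bits b r i s :
  scan match_fw (mst b r None) (enc_bits i s) =
  (mst b (if b && isSome (digit i s) then digit i s else r) None, enc_bits i s).
Proof.
rewrite digitE /enc_bits; set u := take _ _; set v := drop _ _.
have e1 t r' : scan match_fw (mst b r' None) [seq CBit c true | c <- t] =
    (mst b r' None, [seq CBit c true | c <- t]).
  by elim: t => //= c t IH; rewrite /match_fw /= andbF IH.
rewrite scan_cat; have -> : scan match_fw (mst b r None) [seq CBit c false | c <- u] =
  (mst b (if b && isSome (ohead (rev u)) then ohead (rev u) else r) None,
   [seq CBit c false | c <- u]); last by rewrite e1.
elim: u r => [|c u IH] r /=; first by rewrite andbF.
rewrite andbT (IH (if b then Some c else r)) rev_cons.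
by case: b {IH e1} => //=; case: (rev u).
Qed.

Lemma scanr_match_bits r i s :
  scanr match_bw (mst false r None) (enc_bits i s) =
  (mst false r (digit i s), enc_bits i.+1 s).
Proof.
rewrite digitE /enc_bits.
have e1 t : scanr match_bw (mst false r None) [seq CBit c true | c <- t] =
    (mst false r None, [seq CBit c true | c <- t]) by elim: t => //= c t ->.
have e2 t c : scanr match_bw (mst false r (Some c)) [seq CBit c false | c <- t] =
    (mst false r (Some c), [seq CBit c false | c <- t]) by elim: t => //= d t ->.
rewrite scanr_cat e1 /=.
case E: (size s - i) => [|k].
  by rewrite (_ : size s - i.+1 = 0) ?take0 //; lia.
have -> : size s - i.+1 = k by lia.
have ks : k < size s by lia.
rewrite (take_nth false ks) (drop_nth false ks).
by rewrite map_rcons -cats1 scanr_cat /= e2 /= rev_rcons /= -catA.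
Qed.

Definition setE (g : alit -> bool) (st : seq aclause) : seq aclause :=
  [seq ([seq (l.1, LF (fD l.2) (fT l.2) (fP l.2) (g l) (fX l.2) (fV l.2) (fL l.2) (fN l.2))
         | l <- c.1], c.2) | c <- st].

Definition lits (st : seq aclause) : seq alit := flatten (map fst st).

Lemma scan_match x i st (sP : forall l, l \in lits st -> fP l.2 -> l.1.1 = x) r :
  scan match_fw (mst false r None) (enc i st) =
  (mst false (if has (fun l : alit => fP l.2) (lits st) && isSome (digit i (nbits x))
              then digit i (nbits x) else r) None, enc i st).
Proof.
have hl ls b' r' : (forall l, l \in ls -> fP l.2 -> l.1.1 = x) ->
  exists b'', scan match_fw (mst b' r' None) (flatten (map (enc_alit i) ls)) =
  (mst b'' (if has (fun l : alit => fP l.2) ls && isSome (digit i (nbits x))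
    then digit i (nbits x) else r') None, flatten (map (enc_alit i) ls)).
  elim: ls b' r' => [|l ls IH] b' r' h /=; first by exists b'.
  rewrite scan_cat scan_match_bits /=.
  have [|b'' ->] := IH (fP l.2) (if fP l.2 && digit i (nbits l.1.1) then digit i (nbits l.1.1) else r').
    by move=> l' l'ls; apply: h; rewrite inE l'ls orbT.
  exists b''; congr (mst _ _ _, _) => /=.
  case Pl: (fP l.2) => //=; rewrite (h l) ?inE ?eqxx //.
  by case: (has _ _) => //=; case: (digit _ _).
elim: st r sP => [|c st IH] r h //=.
rewrite /enc /= /enc_aclause -catA scan_cat.
have [|b'' ->] := hl c.1 false r.
  by move=> l lc; apply: h; rewrite mem_cat lc.
rewrite /= -/(enc i st) IH; last first.
  by move=> l lc; apply: h; rewrite mem_cat lc orbT.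
rewrite /lits /= has_cat; congr (mst _ _ _, _).
by case: (has _ c.1) => //=; case: (has _ _) => //=; case: (digit _ _).
Qed.

Lemma scanr_match r i st : scanr match_bw (mst false r None) (enc i st) =
  (mst false r None, enc i.+1 (setE (fun l => fE l.2 && (digit i (nbits l.1.1) == r)) st)).
Proof.
have hl ls : scanr match_bw (mst false r None) (flatten (map (enc_alit i) ls)) =
    (mst false r None, flatten (map (enc_alit i.+1)
      [seq (l.1, LF (fD l.2) (fT l.2) (fP l.2) (fE l.2 && (digit i (nbits l.1.1) == r))
             (fX l.2) (fV l.2) (fL l.2) (fN l.2)) | l : alit <- ls])).
  by elim: ls => [|l ls IH] //=; rewrite scanr_cat IH scanr_match_bits.
elim: st => [|c st IH] //; rewrite /enc /= -/(enc i st) scanr_cat IH.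
by rewrite /enc_aclause scanr_cat /= hl.
Qed.

(** * Counting rounds *)

Definition within (n : nat) (c c' : label * seq cell) : Prop :=
  exists2 k, k <= n & mrounds k c c'.

Lemma within_refl c : within 0 c c.
Proof. by exists 0. Qed.

Lemma within_trans m n c1 c2 c3 :
  within m c1 c2 -> within n c2 c3 -> within (m + n) c1 c3.
Proof.
move=> [j jm r1] [k kn r2]; exists (j + k); first exact: leq_add.
exact: rounds_trans r1 r2.
Qed.

Lemma within_le m n c c' : m <= n -> within m c c' -> within n c c'.
Proof. by move=> mn [k km r]; exists k => //; apply: leq_trans km mn. Qed.

Definition is_halt (l : label) : bool := if l is Halt then true else false.

Lemma within_round c c' : ~~ is_halt c.1 -> mround c = c' -> within 1 c c'.
Proof.
by move=> h <-; exists 1 => //; split=> //; apply: contraNneq h => ->.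
Qed.

Lemma within_size n c c' : within n c c' -> size c'.2 = size c.2.
Proof.
move=> [k _]; elim: k c => [|k IH] c /=; first by move=> ->.
by move=> [_ /IH]; rewrite size_round.
Qed.

(** At most [mu s] iterations decrease the measure; the additional one reaches [post]. *)
Lemma within_loop (S : Type) (conf : S -> label * seq cell) (mu : S -> nat)
    (I : S -> Prop) (B : nat) (post : label * seq cell -> Prop) :
  (forall s, I s ->
    (exists2 c, within B (conf s) c & post c) \/
    (exists s', [/\ I s', mu s' < mu s & within B (conf s) (conf s')])) ->
  forall s, I s -> exists2 c, within ((mu s).+1 * B) (conf s) c & post c.
Proof.
move=> step s; have [n] := ubnP (mu s); elim: n s => // n IH s le Is.
case: (step s Is) => [[c r pc]|[s' [Is' lt r]]].
  by exists c => //; apply: within_le r; rewrite mulSn leq_addr.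
have [|c r' pc] := IH s' _ Is'; first exact: leq_trans lt le.
exists c => //; apply: within_le (within_trans r r').
by rewrite -mulSn leq_mul2r ltnS lt orbT.
Qed.

Lemma size_enc_bits i s : size (enc_bits i s) = size s.
Proof. by rewrite size_cat !size_map -size_cat cat_take_drop. Qed.

Lemma size_enc_ge i st : size (lits st) + size st <= size (enc i st).
Proof.
elim: st => //= c st IH; rewrite /enc /lits /= !size_cat -/(enc i st) -/(lits st) /=.
suff : size c.1 <= size (flatten (map (enc_alit i) c.1)) by lia.
by elim: c.1 => //= l ls le; rewrite size_cat ltnS (leq_trans le) // leq_addl.
Qed.

Lemma size_enc_name i st l : l \in lits st -> size (nbits l.1.1) < size (enc i st).
Proof.
elim: st => //= c st IH; rewrite /lits /= mem_cat /enc /= size_cat => /orP[lc|/IH]; last first.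
  by move=> h; apply: leq_trans h _; rewrite leq_addl.
apply: leq_trans (leq_addr _ _); rewrite size_cat addn1 ltnS.
elim: c.1 lc => //= l' ls IHl; rewrite inE size_cat size_enc_bits => /orP[/eqP->|/IHl].
  by rewrite leqW // leq_addr.
by move=> h; apply: (leq_trans h); rewrite leqW // leq_addl.
Qed.

Lemma scan_lit_id q ls : scan (alit_pass lit_id) q ls = (q, ls).
Proof. by elim: ls => //= -[l f] ls IH; rewrite IH. Qed.

Lemma scanr_lit_id q ls : scanr (alit_pass lit_id) q ls = (q, ls).
Proof. by elim: ls => //= -[l f] ls IH; rewrite IH. Qed.

Lemma scan_id st q : scan (aclause_pass lit_id end_id) q st = (q, st).
Proof.
by elim: st => //= -[ls f] st IH; rewrite /aclause_pass /= scan_lit_id IH.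
Qed.

Lemma scanr_id st q : scanr (aclause_passr lit_id end_id) q st = (q, st).
Proof.
by elim: st => //= -[ls f] st IH; rewrite IH /aclause_passr /= scanr_lit_id.
Qed.

Definition map_lits (g : alit -> lflags) (st : seq aclause) : seq aclause :=
  [seq ([seq (l.1, g l) | l <- c.1], c.2) | c <- st].

Lemma map_lits_comp g h st :
  map_lits g (map_lits h st) = map_lits (fun l => g (l.1, h l)) st.
Proof.
rewrite /map_lits -map_comp; apply: eq_map => c /=.
by rewrite -map_comp; congr pair; apply: eq_map.
Qed.

Lemma eq_map_lits g h st : g =1 h -> map_lits g st = map_lits h st.
Proof. by move=> gh; apply: eq_map => c; congr pair; apply: eq_map => l; rewrite gh. Qed.

Lemma map_lits_id g st : (forall l, l \in lits st -> g l = l.2) -> map_lits g st = st.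
Proof.
elim: st => //= -[ls f] st IH h; rewrite IH; last first.
  by move=> l lst; apply: h; rewrite /lits /= mem_cat lst orbT.
rewrite (_ : [seq _ | l <- _] = ls) //= -[RHS]map_id; apply/eq_in_map => -[l fl] lls /=.
by rewrite h // /lits /= mem_cat lls.
Qed.

Lemma lits_map_lits g st : lits (map_lits g st) = [seq (l.1, g l) | l <- lits st].
Proof. by elim: st => //= c st IH; rewrite /lits /= map_cat -/(lits _) IH. Qed.

(** Choosing a source alters only the scratch flags [fP] and [fE], so configurations around a
    comparison are related up to [erase]. *)
Definition eraseP (f : lflags) :=
  LF (fD f) (fT f) false false (fX f) (fV f) (fL f) (fN f).
Definition erase := map_lits (fun l => eraseP l.2).

Lemma map_lits_erase g st st' :
  (forall l, g (l.1, eraseP l.2) = g l) -> erase st = erase st' ->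
  map_lits g st = map_lits g st'.
Proof.
move=> gE e; rewrite -(eq_map_lits _ gE) -(map_lits_comp g (fun l => eraseP l.2)) -/(erase _) e.
by rewrite /erase map_lits_comp; apply: eq_map_lits.
Qed.

Lemma setE_map_lits g st : setE g st = map_lits
  (fun l => LF (fD l.2) (fT l.2) (fP l.2) (g l) (fX l.2) (fV l.2) (fL l.2) (fN l.2)) st.
Proof. by []. Qed.

Definition source_is (st : seq aclause) (l0 : literal) : Prop :=
  [/\ forall l, l \in lits st -> fE l.2, has (fun l : alit => fP l.2) (lits st) &
      forall l, l \in lits st -> fP l.2 -> l.1 = l0].

(** After [i] rounds, [fE] says that the [i] least significant digits agree with those of the
    source. *)
Lemma match_spec r st l0 : source_is st l0 ->
  within (size (nbits l0.1)).+1 (Match r, enc 0 st)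
    (MatchEnd r, enc (size (nbits l0.1)).+1 (setE (fun l => l.1.1 == l0.1) st)).
Proof.
move=> [allE hP sP]; set x := l0.1; set bx := nbits x.
have step i g : mround (Match r, enc i (setE g st)) =
   (if digit i bx then Match r else MatchEnd r,
    enc i.+1 (setE (fun l => g l && (digit i (nbits l.1.1) == digit i bx)) st)).
  rewrite /round /= [ms0]/(mst false None None) (@scan_match x); last first.
    move=> l; rewrite setE_map_lits lits_map_lits => /mapP[l' l'st -> /= Pl'].
    by rewrite (sP _ l'st).
  have -> : has (fun l : alit => fP l.2) (lits (setE g st)).
    by rewrite setE_map_lits lits_map_lits has_map; apply: etrans hP; apply: eq_has.
  rewrite /= -/bx; have -> : (if digit i bx then digit i bx else None) = digit i bx.
    by case: (digit i bx).
  rewrite scanr_match /=; congr (_, enc _ _).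
  by rewrite !setE_map_lits map_lits_comp.
pose G j (l : alit) := all (fun i => digit i (nbits l.1.1) == digit i bx) (iota 0 j).
have GS j : setE (fun l => G j l && (digit j (nbits l.1.1) == digit j bx)) st = setE (G j.+1) st.
  apply: eq_map => c; congr pair; apply: eq_map => l.
  by rewrite /G -addn1 iotaD all_cat /= andbT.
have loop j : j <= size bx ->
    within j (Match r, enc 0 st) (Match r, enc j (setE (G j) st)).
  elim: j => [|j IH] lt.
    rewrite (_ : setE (G 0) st = st); first exact: within_refl.
    apply: map_lits_id => -[l f] lst; have := allE _ lst.
    by case: f {lst} => /= ? ? ? ? ? ? ? ? ->.
  rewrite -addn1; apply: within_trans (IH (ltnW lt)) _.
  apply: within_round => //; rewrite step GS addn1.
  by rewrite {1}/digit onthTE size_rev lt.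
(* The additional round finds the source name exhausted: it ends the loop, and only names exhausted
   as well keep [fE], which compares lengths. *)
rewrite -addn1; apply: within_trans (loop _ (leqnn _)) _.
apply: within_round => //; rewrite step GS addn1.
rewrite /digit onth_default ?size_rev // -/(digit _ _); congr (_, enc _ _).
apply: eq_map => c; congr pair; apply: eq_map => l; congr (_, LF _ _ _ _ _ _ _ _).
apply/allP/eqP => [h|-> //]; apply: (can_inj nbitsK); apply/esym/digit_inj => i ib.
by apply/esym/eqP/h; rewrite mem_iota.
Qed.

(** * Picking variables and literals *)

Lemma lits_scan tl q st :
  (scan (aclause_pass tl end_id) q st).1 = (scan (alit_pass tl) q (lits st)).1 /\
  lits (scan (aclause_pass tl end_id) q st).2 = (scan (alit_pass tl) q (lits st)).2.
Proof.
elim: st q => //= c st IH q; rewrite /lits /= scan_cat /= -/(lits st).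
by have [-> e] := IH (scan (alit_pass tl) q c.1).1; split; rewrite // -e.
Qed.

Lemma erase_pick p q st : erase (scan (aclause_pass (lit_pick p) end_id) q st).2 = erase st.
Proof.
have hl ls q' : [seq (l.1, eraseP l.2) | l <- (scan (alit_pass (lit_pick p)) q' ls).2] =
    [seq (l.1, eraseP l.2) | l : alit <- ls].
  by elim: ls q' => //= l ls IH q'; rewrite IH.
elim: st q => //= c st IH q; rewrite /erase /= in IH *; rewrite IH.
by congr ((_, _) :: _); rewrite /= hl.
Qed.

Lemma lit_pickP p st (r := scan (aclause_pass (lit_pick p) end_id) ms0 st) :
  [/\ r.1 = bst (has (fun l : alit => p l.2) (lits st)) false false false,
      erase r.2 = erase st &
      has (fun l : alit => p l.2) (lits st) ->
        exists2 l0, l0 \in lits st & p l0.2 /\ source_is r.2 l0.1].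
Proof.
have [e1 e2] := lits_scan (lit_pick p) ms0 st.
rewrite -/r in e1 e2.
have h1 ls b : (scan (alit_pass (lit_pick p)) (bst b false false false) ls).1 =
    bst (b || has (fun l : alit => p l.2) ls) false false false.
  elim: ls b => /= [|l ls IH] b; first by rewrite orbF.
  by rewrite (IH (b || ~~ b && p l.2)); case: b.
have hE ls q l : l \in (scan (alit_pass (lit_pick p)) q ls).2 -> fE l.2.
  by elim: ls q => //= l' ls IH q; rewrite inE => /orP[/eqP-> //|/IH].
have hN ls l : l \in (scan (alit_pass (lit_pick p)) (bst true false false false) ls).2 -> fP l.2 = false.
  by elim: ls => //= l' ls IH; rewrite inE => /orP[/eqP-> //|/IH].
split; [by rewrite e1 h1|exact: erase_pick|].
move=> hp; suff [l0 l0st [pl0 [hP aP]]] : exists2 l0, l0 \in lits st & p l0.2 /\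
   (has (fun l : alit => fP l.2) (lits r.2) /\
    forall l, l \in lits r.2 -> fP l.2 -> l.1 = l0.1).
  by exists l0 => //; split=> //; split=> // l; rewrite e2 => /hE.
rewrite e2; elim: (lits st) hp => //= l ls IH.
case pl: (p l.2) => /= hp.
  exists l; rewrite ?inE ?eqxx //; split=> //; split=> // l'.
  by rewrite inE => /orP[/eqP->|/hN ->].
have [l0 l0ls [pl0 [hP aP]]] := IH hp.
exists l0; rewrite ?inE ?l0ls ?orbT //; split=> //; split=> [|l'] //.
by rewrite inE => /orP[/eqP-> //|/aP].
Qed.

Lemma pick_round l p st : mfw l = pass (lit_pick p) end_id -> mbw l = pass_id ->
  exists2 st', mround (l, enc 0 st) =
     (mnext l (bst (has (fun l : alit => p l.2) (lits st)) false false false), enc 0 st') &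
   erase st' = erase st /\ (has (fun l : alit => p l.2) (lits st) ->
     exists2 l0, l0 \in lits st & p l0.2 /\ source_is st' l0.1).
Proof.
move=> e1 e2; rewrite (round_pass 0 st e1 e2) scanr_id /=.
by have [h1 h2 h3] := lit_pickP p st; rewrite h1; eexists.
Qed.

Definition prepare (x : nat) (st : seq aclause) : seq aclause :=
  [seq ([seq (l.1, LF (fD l.2) (fT l.2 || (l.1.1 == x)) false false (l.1.1 == x)
                      (fV l.2) (fL l.2) (fN l.2)) | l : alit <- c.1],
        CF (gD c.2) false false (has (fun l : alit => ~~ fD l.2 && (l.1.1 == x)) c.1)
           (gS c.2) (gO c.2) false) | c : aclause <- st].

Lemma round_variable i st : mround (MatchEnd false, enc i st) = (PickClause, enc 0
  [seq ([seq (l.1, LF (fD l.2) (fT l.2 || fE l.2) false false (fE l.2)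
                      (fV l.2) (fL l.2) (fN l.2)) | l : alit <- c.1],
        CF (gD c.2) false false (has (fun l : alit => ~~ fD l.2 && fE l.2) c.1)
           (gS c.2) (gO c.2) false) | c : aclause <- st]).
Proof.
rewrite (round_pass (tl := lit_variable) (te := end_variable) (tl' := lit_id) (te' := end_id)) //.
rewrite scanr_id /=; congr (_, enc _ _).
have hl ls b : scan (alit_pass lit_variable) (bst b false false false) ls =
  (bst (b || has (fun l : alit => ~~ fD l.2 && fE l.2) ls) false false false,
   [seq (l.1, LF (fD l.2) (fT l.2 || fE l.2) false false (fE l.2)
                      (fV l.2) (fL l.2) (fN l.2)) | l : alit <- ls]).
  by elim: ls b => /= [|l ls IH] b; rewrite ?orbF // IH /= orbA.
by elim: st => //= c st IH; rewrite hl IH.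
Qed.

Lemma pick_variable st (N := size (enc 0 st)) :
  has (fun l : alit => untried l.2) (lits st) ->
  exists l0 : alit, [/\ l0 \in lits st, untried l0.2 &
    within (N + 3) (PickVar, enc 0 st) (PickClause, enc 0 (prepare l0.1.1 st))].
Proof.
move=> hp; have [st' e [er /(_ hp)[l0 l0st [ul0 src]]]] := @pick_round PickVar untried st erefl erefl.
rewrite hp /= in e; exists l0; split=> //.
have w1 := within_round (c := (PickVar, enc 0 st)) isT e.
have w2 := match_spec false src.
have w3 := within_round (c := (MatchEnd false, _)) isT
  (round_variable (size (nbits l0.1.1)).+1 (setE (fun l => l.1.1 == l0.1.1) st')).
have := within_trans w1 (within_trans w2 w3).
(* One round to pick, one per digit and one more to compare, one to conclude; a name is shorter than
   the tape. *)
move=> /(within_le (n := N + 3)) w; have le : 1 + ((size (nbits l0.1.1)).+1 + 1) <= N + 3.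
  by have := size_enc_name 0 l0st; rewrite /N; lia.
have := w le; congr (within _ _ (_, enc _ _)).
have -> : prepare l0.1.1 st = prepare l0.1.1 st'.
  have pe s : prepare l0.1.1 s = prepare l0.1.1 (erase s).
    rewrite /prepare /erase /map_lits -map_comp; apply: eq_map => c /=.
    by rewrite -map_comp has_map; congr ((_, _)); apply: eq_map.
  by rewrite pe -er -pe.
rewrite /prepare setE_map_lits /map_lits -map_comp; apply: eq_map => c /=.
by rewrite -map_comp has_map; congr ((_, _)); apply: eq_map.
Qed.

Lemma pick_variable_none st : ~~ has (fun l : alit => untried l.2) (lits st) ->
  exists2 st', erase st' = erase st & within 1 (PickVar, enc 0 st) (Fin0, enc 0 st').
Proof.
move=> /negbTE hp; have [st' e [er _]] := @pick_round PickVar untried st erefl erefl.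
by exists st' => //; apply: within_round => //; rewrite e hp.
Qed.

(** All copies of [k] leave the work list [fN] together, so repeated literals in a clause are
    handled once. *)
Definition mark (k : literal) : seq aclause -> seq aclause := map_lits (fun l =>
  LF (fD l.2) (fT l.2) false false (fX l.2) (fV l.2 || (l.1.1 == k.1))
     (fL l.2 || (l.1 == k)) (fN l.2 && (l.1 != k))).

Lemma round_mark i st l0 : has (fun l : alit => fP l.2) (lits st) ->
  (forall l, l \in lits st -> fP l.2 -> l.1 = l0) ->
  mround (MatchEnd true, enc i st) = (PickLit, enc 0 (map_lits (fun l =>
  LF (fD l.2) (fT l.2) false false (fX l.2) (fV l.2 || fE l.2)
     (fL l.2 || (fE l.2 && (l.1.2 == l0.2))) (fN l.2 && ~~ (fE l.2 && (l.1.2 == l0.2)))) st)).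
Proof.
move=> hP sP.
rewrite (round_pass (tl := lit_source) (te := end_id) (tl' := lit_mark) (te' := end_id)) //=.
have hid q : (scan (aclause_pass lit_source end_id) q st).2 = st.
  have hl q' ls : (scan (alit_pass lit_source) q' ls).2 = ls.
    by elim: ls q' => //= -[l f] ls IH q'; rewrite IH.
  by elim: st q {hP sP} => //= -[ls f] st IH q; rewrite hl IH.
have [-> _] := lits_scan lit_source ms0 st; rewrite hid.
have -> : (scan (alit_pass lit_source) ms0 (lits st)).1 = bst l0.2 false false false.
  have h1 ls b : (forall l : alit, l \in ls -> fP l.2 -> l.1 = l0) ->
     (scan (alit_pass lit_source) (bst b false false false) ls).1 =
     bst (if has (fun l : alit => fP l.2) ls then l0.2 else b) false false false.
    elim: ls b => //= l ls IH b h; rewrite (IH (if fP l.2 then l.1.2 else b)); last first.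
      by move=> l' l'ls; apply: h; rewrite inE l'ls orbT.
    case Pl: (fP l.2) => //=; rewrite (h l) ?inE ?eqxx //.
    by case: (has _ _).
  by rewrite h1 // hP.
set q := bst _ _ _ _.
have hl ls : scanr (alit_pass lit_mark) q ls = (q, [seq (l.1,
   LF (fD l.2) (fT l.2) false false (fX l.2) (fV l.2 || fE l.2)
     (fL l.2 || (fE l.2 && (l.1.2 == l0.2))) (fN l.2 && ~~ (fE l.2 && (l.1.2 == l0.2))))
     | l : alit <- ls]) by elim: ls => //= l ls ->.
have -> // : scanr (aclause_passr lit_mark end_id) q st = (q, map_lits (fun l =>
  LF (fD l.2) (fT l.2) false false (fX l.2) (fV l.2 || fE l.2)
     (fL l.2 || (fE l.2 && (l.1.2 == l0.2))) (fN l.2 && ~~ (fE l.2 && (l.1.2 == l0.2)))) st).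
by elim: st {hP sP hid} => //= c st ->; rewrite /aclause_passr /= hl.
Qed.

Lemma pick_literal st (N := size (enc 0 st)) :
  has (fun l : alit => fN l.2) (lits st) ->
  exists l0 : alit, [/\ l0 \in lits st, fN l0.2 &
    within (N + 3) (PickLit, enc 0 st) (PickLit, enc 0 (mark l0.1 st))].
Proof.
move=> hp; have [st' e [er /(_ hp)[l0 l0st [ul0 src]]]] := @pick_round PickLit fN st erefl erefl.
rewrite hp /= in e; exists l0; split=> //.
have w1 := within_round (c := (PickLit, enc 0 st)) isT e.
have w2 := match_spec true src.
have [allE hP sP] := src.
have hP' : has (fun l : alit => fP l.2) (lits (setE (fun l => l.1.1 == l0.1.1) st')).
  by rewrite setE_map_lits lits_map_lits has_map; apply: etrans hP; apply: eq_has.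
have sP' l : l \in lits (setE (fun l => l.1.1 == l0.1.1) st') -> fP l.2 -> l.1 = l0.1.
  by rewrite setE_map_lits lits_map_lits => /mapP[l' l'st -> /= Pl']; rewrite (sP l').
have w3 := within_round (c := (MatchEnd true, _)) isT
  (round_mark (size (nbits l0.1.1)).+1 hP' sP').
have le : 1 + ((size (nbits l0.1.1)).+1 + 1) <= N + 3.
  by have := size_enc_name 0 l0st; rewrite /N; lia.
have := within_le le (within_trans w1 (within_trans w2 w3)).
rewrite setE_map_lits map_lits_comp; congr (within _ _ (_, enc _ _)).
have -> : mark l0.1 st = mark l0.1 st' by apply/esym/map_lits_erase.
apply: eq_map_lits => -[[y b] f]; case: l0.1 => y' b' /=.
by rewrite (_ : ((y, b) == (y', b')) = ((y == y') && (b == b'))).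
Qed.

Lemma pick_literal_none st : ~~ has (fun l : alit => fN l.2) (lits st) ->
  exists2 st', erase st' = erase st & within 1 (PickLit, enc 0 st) (Check, enc 0 st').
Proof.
move=> /negbTE hp; have [st' e [er _]] := @pick_round PickLit fN st erefl erefl.
by exists st' => //; apply: within_round => //; rewrite e hp.
Qed.

(** * Picking, checking and counting clauses *)

Definition not_current (c : aclause) : aclause :=
  ([seq (l.1, LF (fD l.2) (fT l.2) (fP l.2) (fE l.2) (fX l.2) false false false)
    | l : alit <- c.1],
   CF (gD c.2) (gT c.2) false (gI c.2) (gS c.2) (gO c.2) (gK c.2)).
Definition current (c : aclause) : aclause :=
  ([seq (l.1, LF (fD l.2) (fT l.2) (fP l.2) (fE l.2) (fX l.2) false false (~~ fD l.2))
    | l : alit <- c.1],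
   CF (gD c.2) true true (gI c.2) (gS c.2) (gO c.2) (gK c.2)).
Definition candidate (c : aclause) : bool := gI c.2 && ~~ gT c.2.

Lemma scanr_current b1 b2 b st :
  scanr (aclause_passr lit_current end_current) (bst b1 b2 b false) st =
   (bst b1 b2 (if st is c :: _ then gC c.2 else b) false,
    [seq ([seq (l.1, LF (fD l.2) (fT l.2) (fP l.2) (fE l.2) (fX l.2) false false
             (gC c.2 && ~~ fD l.2)) | l : alit <- c.1], c.2) | c : aclause <- st]).
Proof.
elim: st => [|c st IH] //=; rewrite IH /aclause_passr /=.
set q' := bst _ _ (gC c.2) _.
have -> // : scanr (alit_pass lit_current) q' c.1 =
  (q', [seq (l.1, LF (fD l.2) (fT l.2) (fP l.2) (fE l.2) (fX l.2) false false
             (gC c.2 && ~~ fD l.2)) | l : alit <- c.1]).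
by elim: c.1 => //= l ls ->.
Qed.

Definition unpicked (c : aclause) : aclause :=
  (c.1, CF (gD c.2) (gT c.2) false (gI c.2) (gS c.2) (gO c.2) (gK c.2)).
Definition picked (c : aclause) : aclause :=
  (c.1, CF (gD c.2) true true (gI c.2) (gS c.2) (gO c.2) (gK c.2)).

Lemma pick_clause_step b1 b2 c (h := ~~ b1 && candidate c) :
  aclause_pass lit_id end_pick (bst b1 b2 false false) c =
  (bst (b1 || h) (b2 || gI c.2) false false,
   (c.1, CF (gD c.2) (gT c.2 || h) h (gI c.2) (gS c.2) (gO c.2) (gK c.2))).
Proof. by rewrite /aclause_pass scan_lit_id. Qed.

Lemma scan_cons (Q A : Type) (f : Q -> A -> Q * A) q x s : scan f q (x :: s) =
  ((scan f (f q x).1 s).1, (f q x).2 :: (scan f (f q x).1 s).2).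
Proof. by []. Qed.

Lemma scan_unpicked b1 b2 st : b1 || ~~ has candidate st ->
  scan (aclause_pass lit_id end_pick) (bst b1 b2 false false) st =
  (bst b1 (b2 || has (fun c : aclause => gI c.2) st) false false, map unpicked st).
Proof.
elim: st b2 => [|c st IH] b2 h; first by rewrite /= orbF.
rewrite /= in h; have hc : ~~ b1 && candidate c = false.
  by move: h; case: b1 {IH} => //=; rewrite negb_or => /andP[/negbTE].
have hs : b1 || ~~ has candidate st.
  by move: h; case: b1 {IH hc} => //=; rewrite negb_or => /andP[].
by rewrite scan_cons pick_clause_step hc /= orbF IH //= orbA /unpicked orbF.
Qed.

Lemma scan_picked b2 st : has candidate st -> exists st1 c st2,
  [/\ st = st1 ++ c :: st2, candidate c &
   scan (aclause_pass lit_id end_pick) (bst false b2 false false) st =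
   (bst true (b2 || has (fun c : aclause => gI c.2) st) false false,
    map unpicked st1 ++ picked c :: map unpicked st2)].
Proof.
elim: st b2 => // c st IH b2; rewrite scan_cons pick_clause_step /=.
have [pc _|pc /= hst] := boolP (candidate c).
  exists [::], c, st; split=> //.
  by rewrite scan_unpicked //= orbA /picked orbT.
have [st1 [c' [st2 [e pc' es]]]] := IH (b2 || gI c.2) hst.
exists (c :: st1), c', st2; split=> //; first by rewrite e.
by rewrite es /= orbA /unpicked orbF.
Qed.


Lemma round_pick_clause st : has candidate st -> exists st1 c st2,
  [/\ st = st1 ++ c :: st2, candidate c &
   mround (PickClause, enc 0 st) =
   (PickLit, enc 0 (map not_current st1 ++ current c :: map not_current st2))].
Proof.
move=> /(scan_picked false)[st1 [c [st2 [e pc es]]]]; exists st1, c, st2; split=> //.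
rewrite (round_pass (tl := lit_id) (te := end_pick) (tl' := lit_current) (te' := end_current)) //.
rewrite es scanr_current /=; congr (_, enc _ _).
by rewrite map_cat /= -!map_comp.
Qed.

Lemma round_pick_clause_none st : ~~ has candidate st ->
  mround (PickClause, enc 0 st) =
  (if has (fun c : aclause => gI c.2) st then PickVar else Commit,
   enc 0 (map not_current st)).
Proof.
move=> h.
rewrite (round_pass (tl := lit_id) (te := end_pick) (tl' := lit_current) (te' := end_current)) //.
rewrite scan_unpicked // scanr_current /=; congr (_, enc _ _).
by rewrite -map_comp.
Qed.

Definition live_all (p : pred alit) (c : aclause) : bool :=
  all (fun l : alit => fD l.2 || p l) c.1.
Definition uncovered (c : aclause) : bool :=
  gI c.2 && ~~ live_all (fun l => fV l.2) c.
Definition checked (c : aclause) : aclause :=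
  ([seq (l.1, eraseP l.2) | l : alit <- c.1],
   CF (gD c.2) (gT c.2) (gC c.2) (gI c.2)
      (gI c.2 && ~~ gC c.2 && live_all (fun l => fL l.2) c)
      (gI c.2 && ~~ gC c.2 && live_all (fun l => if fX l.2 then ~~ fL l.2 else fL l.2) c)
      (gK c.2)).

Lemma round_check st : mround (Check, enc 0 st) =
  (if has uncovered st then PickClause else Count, enc 0 (map checked st)).
Proof.
rewrite (round_pass (tl := lit_check) (te := end_check) (tl' := lit_id) (te' := end_id)) //.
have hl ls b1 b2 b3 b4 : scan (alit_pass lit_check) (bst b1 b2 b3 b4) ls =
  (bst b1 (b2 || ~~ all (fun l : alit => fD l.2 || fV l.2) ls)
    (b3 || ~~ all (fun l : alit => fD l.2 || fL l.2) ls)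
    (b4 || ~~ all (fun l : alit => fD l.2 || (if fX l.2 then ~~ fL l.2 else fL l.2)) ls),
   [seq (l.1, eraseP l.2) | l : alit <- ls]).
  elim: ls b2 b3 b4 => [|l ls IH] b2 b3 b4 /=; first by rewrite !orbF.
  rewrite /lit_check /=; case Dl: (fD l.2) => /=; first by rewrite IH /eraseP Dl.
  by rewrite IH /= /eraseP Dl !negb_and !orbA; case: (fX l.2); rewrite ?negbK.
have hst s b : scan (aclause_pass lit_check end_check) (bst b false false false) s =
   (bst (b || has uncovered s) false false false, map checked s).
  elim: s b => [|c s IH] b; first by rewrite /= orbF.
  by rewrite scan_cons /aclause_pass hl /= IH /= -orbA /checked /ms3 /ms4 /= !negbK.
by rewrite hst scanr_id.
Qed.

Definition decide (k : bool) (c : aclause) : aclause :=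
  (c.1, CF (gD c.2) false false (gI c.2 && ~~ gC c.2) false false
           (if gC c.2 then ~~ k else gK c.2)).

(** Removing one flag of each kind preserves the strict comparison. The last round may still remove
    a flag of one kind, which does not matter since [decide] clears them all. *)
Lemma count_loop st :
  within (count (fun c : aclause => gS c.2) st).+1 (Count, enc 0 st)
   (PickClause, enc 0 (map (decide (count (fun c : aclause => gS c.2) st <
      count (fun c : aclause => gO c.2) st)) st)).
Proof.
have fwd b1 b2 s : let r := scan (aclause_pass lit_id end_count) (bst b1 b2 false false) s in
  [/\ r.1 = bst (b1 || has (fun c : aclause => gS c.2) s)
        (b2 || has (fun c : aclause => gO c.2) s) false false,
      count (fun c : aclause => gS c.2) r.2 =
        count (fun c : aclause => gS c.2) s - (~~ b1),
      count (fun c : aclause => gO c.2) r.2 =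
        count (fun c : aclause => gO c.2) s - (~~ b2) &
      forall k, map (decide k) r.2 = map (decide k) s].
  elim: s b1 b2 => [|c s IH] b1 b2 /=; first by rewrite !orbF.
  rewrite /aclause_pass /= scan_lit_id /=.
  have [-> -> -> e] := IH (b1 || gS c.2) (b2 || gO c.2); split; rewrite ?orbA //.
  - by rewrite /ms1 /=; case: b1 {IH e}; case: (gS c.2) => //=; lia.
  - by rewrite /ms2 /=; case: b2 {IH e}; case: (gO c.2) => //=; lia.
  - by move=> k; rewrite e.
have bwd b1 b2 s : scanr (aclause_passr lit_id end_decide) (bst b1 b2 false false) s =
    (bst b1 b2 false false, if b1 && b2 then s else map (decide b2) s).
  elim: s => [|c s IH] /=; first by rewrite if_same.
  rewrite IH /aclause_passr /= scanr_lit_id /= /end_decide /ms1 /ms2 /=.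
  by case: (b1 && b2) => //; case: c {IH}.
have rnd s : mround (Count, enc 0 s) =
   let hS := has (fun c : aclause => gS c.2) s in
   let hO := has (fun c : aclause => gO c.2) s in
   let r := (scan (aclause_pass lit_id end_count) ms0 s).2 in
   (if hS && hO then Count else PickClause, enc 0 (if hS && hO then r else map (decide hO) s)).
  rewrite (round_pass (tl := lit_id) (te := end_count) (tl' := lit_id) (te' := end_decide)) //=.
  have [e _ _ ed] := fwd false false s; rewrite -/ms0 in e ed; rewrite e bwd /=.
  by rewrite ed.
move e: (count (fun c : aclause => gS c.2) st) => n.
elim: n st e => [|n IH] st e.
  apply: within_round => //; rewrite rnd /= !has_count e /=.
  by congr (_, enc _ (map (decide _) _)).
have [hO|hO] := boolP (has (fun c : aclause => gO c.2) st); last first.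
  apply: (@within_le 1) => //; apply: within_round => //; rewrite rnd /= (negbTE hO) andbF.
  move: hO; rewrite has_count -leqNgt leqn0 => /eqP->; by rewrite ltn0.
have [_ eS eO ed] := fwd false false st; rewrite -/ms0 /= in eS eO ed.
set r := (scan _ _ _).2 in eS eO ed.
rewrite -add1n; apply: within_trans (_ : within 1 _ (Count, enc 0 r)) _.
  by apply: within_round => //; rewrite rnd /= hO has_count e.
have := IH r; rewrite eS e subn1 => /(_ erefl); rewrite ed eO.
by rewrite has_count in hO; rewrite -(ltn_predRL) -subn1.
Qed.

Definition committed (c : aclause) : aclause :=
  ([seq (l.1, LF (fD l.2 || fX l.2 || (gD c.2 || gK c.2)) false (fP l.2) (fE l.2) (fX l.2)
           (fV l.2) (fL l.2) (fN l.2)) | l : alit <- c.1],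
   CF (gD c.2 || gK c.2) (gT c.2) (gC c.2) (gI c.2) (gS c.2) (gO c.2) (gK c.2)).

Lemma round_commit st : mround (Commit, enc 0 st) = (PickVar, enc 0 (map committed st)).
Proof.
rewrite (round_pass (tl := lit_id) (te := end_id) (tl' := lit_commit) (te' := end_commit)) //.
rewrite scan_id /=; congr (_, enc _ _); elim: st => //= c st ->; congr (_ :: _).
rewrite /aclause_passr /=; set q := bst _ _ _ _.
have -> // : scanr (alit_pass lit_commit) q c.1 =
  (q, [seq (l.1, LF (fD l.2 || fX l.2 || (gD c.2 || gK c.2)) false (fP l.2) (fE l.2)
         (fX l.2) (fV l.2) (fL l.2) (fN l.2)) | l : alit <- c.1]).
by elim: c.1 => //= l ls ->.
Qed.

Lemma count_lt (T : eqType) (p q : pred T) (s : seq T) x :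
  subpred p q -> x \in s -> q x -> ~~ p x -> count p s < count q s.
Proof.
move=> pq; elim: s => //= y s IH; rewrite inE => /orP[/eqP<-|/IH h] qx px.
  by rewrite qx (negbTE px) add0n add1n ltnS sub_count.
rewrite -addnS; apply: leq_add (h qx px).
by case py: (p y) => //; rewrite (pq _ py).
Qed.

(** * The part of a configuration that matters for correctness *)

Definition core_lit := (literal * (bool * bool * bool))%type.
(** The first component is what peeling leaves unchanged, the final triple what it updates;
    invariants can thus fix [map fst]. *)
Definition view := (seq core_lit * bool * (bool * bool * bool))%type.
Definition core_of (l : alit) : core_lit := (l.1, (fD l.2, fT l.2, fX l.2)).
Definition view_of (c : aclause) : view :=
  ([seq core_of l | l <- c.1], gD c.2, (gI c.2, gT c.2, gK c.2)).
Definition cD (u : core_lit) := u.2.1.1.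
Definition cT (u : core_lit) := u.2.1.2.
Definition cX (u : core_lit) := u.2.2.
Definition vlits (v : view) := v.1.1.
Definition vD (v : view) := v.1.2.
Definition vI (v : view) := v.2.1.1.
Definition vT (v : view) := v.2.1.2.
Definition vK (v : view) := v.2.2.
Definition vclause (v : view) : clause := [seq u.1 | u <- vlits v & ~~ cD u].
Definition set_flags (v : view) (i t k : bool) : view := (v.1, (i, t, k)).

Lemma all_vclause (p : pred literal) v :
  all p (vclause v) = all (fun u => cD u || p u.1) (vlits v).
Proof.
by rewrite all_map all_filter; apply: eq_all => u /=; rewrite implybE negbK.
Qed.

Definition marked1 (K : clause) (c : aclause) : aclause :=
  ([seq (l.1, LF (fD l.2) (fT l.2) false false (fX l.2) (l.1.1 \in vars K) (l.1 \in K)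
              (fN l.2 && (l.1 \notin K))) | l : alit <- c.1], c.2).
Definition marked (K : clause) (st : seq aclause) := map (marked1 K) st.

Lemma marked_map_lits K st : marked K st = map_lits (fun l =>
  LF (fD l.2) (fT l.2) false false (fX l.2) (l.1.1 \in vars K) (l.1 \in K)
              (fN l.2 && (l.1 \notin K))) st.
Proof. by []. Qed.

Definition selected st1 c st2 := map not_current st1 ++ current c :: map not_current st2.

Lemma lits_cat st1 st2 : lits (st1 ++ st2) = lits st1 ++ lits st2.
Proof. by rewrite /lits map_cat flatten_cat. Qed.

Lemma todo_selected st1 c st2 l :
  l \in lits (selected st1 c st2) -> fN l.2 -> l.1 \in vclause (view_of c).
Proof.
have nc st : l \in lits (map not_current st) -> fN l.2 = false.
  elim: st => //= c' st IH; rewrite /lits /= mem_cat => /orP[/mapP[l' _ ->] //|]; exact: IH.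
rewrite lits_cat mem_cat => /orP[/nc-> //|]; rewrite /lits /= mem_cat.
move=> /orP[/mapP[l' l'c ->] /= Dl'|/nc -> //].
apply/mapP; exists (core_of l') => //; rewrite mem_filter Dl'.
exact: map_f.
Qed.

Lemma selected_todo st1 c st2 k : k \in vclause (view_of c) ->
  exists l, [/\ l \in lits (selected st1 c st2), fN l.2 & l.1 = k].
Proof.
move=> /mapP[u]; rewrite mem_filter => /andP[Du /mapP[l lc eu]] ->; subst u.
exists (l.1, LF (fD l.2) (fT l.2) (fP l.2) (fE l.2) (fX l.2) false false (~~ fD l.2)).
split=> //; rewrite lits_cat mem_cat /lits /= mem_cat; apply/orP; right; apply/orP; left.
by apply/mapP; exists l.
Qed.

(** The invariant is that exactly the literals of some subset [K] of the current clause are marked;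
    the measure is the number of flags [fN]. *)
Lemma mark_loop st1 c st2 (s0 := selected st1 c st2) (N := size (enc 0 s0)) :
  exists2 st', erase st' = marked (vclause (view_of c)) s0 &
    within (N.+1 * (N + 3)) (PickLit, enc 0 s0) (Check, enc 0 st').
Proof.
pose I st := size (enc 0 st) = N /\
  exists2 K, {subset K <= vclause (view_of c)} & erase st = marked K s0.
pose mu st := count (fun l : alit => fN l.2) (lits st).
pose post c' := exists2 st', erase st' = marked (vclause (view_of c)) s0 &
   c' = (Check, enc 0 st').
have step st : I st ->
    (exists2 c', within (N + 3) (PickLit, enc 0 st) c' & post c') \/
    (exists st', [/\ I st', mu st' < mu st & within (N + 3) (PickLit, enc 0 st) (PickLit, enc 0 st')]).
  move=> [szst [K sK eK]].
  have litE l : l \in lits st -> exists l', [/\ l' \in lits s0, l'.1 = l.1 &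
      fN l.2 = fN l'.2 && (l'.1 \notin K)].
    move=> lst; have : (l.1, eraseP l.2) \in lits (erase st).
      by rewrite lits_map_lits; apply/mapP; exists l.
    rewrite eK marked_map_lits lits_map_lits => /mapP[l' l's0 [-> _ _ _ _ _ ->]].
    by exists l'.
  have [hN|hN] := boolP (has (fun l : alit => fN l.2) (lits st)).
    right; have [l0 [l0st Nl0 w]] := pick_literal hN; exists (mark l0.1 st).
    rewrite szst in w; split=> //.
      split; first by have /= := within_size w; rewrite szst.
      exists (l0.1 :: K).
        move=> k; rewrite inE => /orP[/eqP->|/sK //].
        have [l' [l's0 <- e]] := litE _ l0st; rewrite e in Nl0.
        by case/andP: Nl0 => Nl' _; apply: todo_selected l's0 Nl'.
      have -> : erase (mark l0.1 st) = mark l0.1 (erase st).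
        by rewrite /erase /mark !map_lits_comp.
      rewrite eK !marked_map_lits /mark map_lits_comp; apply: eq_map_lits => l /=.
      congr LF; rewrite ?inE; [exact: orbC|exact: orbC|].
      by rewrite negb_or -andbA [in RHS](andbC (_ != _)).
    rewrite /mu /mark lits_map_lits count_map; apply: (count_lt (x := l0)) => //=.
      by move=> l /= /andP[].
    by rewrite eqxx andbF.
  left; have [st' er w] := pick_literal_none hN.
  exists (Check, enc 0 st'); first by apply: within_le w; lia.
  exists st' => //; rewrite er eK !marked_map_lits.
  (* A literal of the clause outside [K] would still carry [fN], but none is left. *)
  have KE : K =i vclause (view_of c).
    move=> k; apply/idP/idP => [/sK //|/(selected_todo st1 st2)[l [ls0 Nl <-]]].
    apply: contraNT hN => lK; apply/hasP.
    have : (l.1, LF (fD l.2) (fT l.2) false false (fX l.2) (l.1.1 \in vars K) (l.1 \in K)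
              (fN l.2 && (l.1 \notin K))) \in lits (erase st).
      by rewrite eK marked_map_lits lits_map_lits; apply/mapP; exists l.
    rewrite /erase lits_map_lits => /mapP[l' l'st [_ _ _ _ _ _ e]].
    by exists l' => //; rewrite -e Nl lK.
  have vE y : (y \in vars K) = (y \in vars (vclause (view_of c))).
    by apply/mapP/mapP => -[k kK ->]; exists k => //; rewrite ?KE // -KE.
  by apply: eq_map_lits => l; rewrite vE !KE.
have I0 : I s0.
  split=> //; exists [::] => //; rewrite /s0 /selected /erase /map_lits /marked !map_cat /= -!map_comp.
  by congr (_ ++ _ :: _); [apply: eq_map => c' /=|rewrite /marked1 /=|apply: eq_map => c' /=];
    rewrite /marked1 /= -!map_comp; congr pair; apply: eq_map => l /=; rewrite /eraseP /= ?andbT.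
have [c' w [st' est' ec']] := within_loop step I0; rewrite ec' in w.
exists st' => //; apply: within_le w; rewrite leq_mul2r; apply/orP; right.
rewrite ltnS; apply: leq_trans (count_size _ _) _.
by have := size_enc_ge 0 s0; rewrite /N; lia.
Qed.

Lemma checked_erase st : map checked (erase st) = map checked st.
Proof.
rewrite -map_comp; apply: eq_map => c /=; rewrite /checked /live_all /= -map_comp !all_map.
by congr ((_, _)).
Qed.

Lemma uncovered_erase st : has uncovered (erase st) = has uncovered st.
Proof. by rewrite has_map; apply: eq_has => c; rewrite /= /uncovered /live_all /= all_map. Qed.

Definition covers (Ci C : clause) : bool := all (fun y => y \in vars Ci) (vars C).

Lemma uncovered_marked K c : uncovered (marked1 K c) =
  vI (view_of c) && ~~ covers K (vclause (view_of c)).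
Proof.
rewrite /uncovered /live_all /covers [in RHS]all_map all_vclause /vlits /= !all_map.
by congr (_ && ~~ _); apply: eq_all.
Qed.

Lemma has_uncovered_marked K st : has uncovered (marked K st) =
  has (fun v => vI v && ~~ covers K (vclause v)) (map view_of st).
Proof. by rewrite !has_map; apply: eq_has => c; rewrite /= uncovered_marked. Qed.

Lemma view_not_current c : view_of (not_current c) = view_of c.
Proof. by rewrite /view_of /not_current /= -map_comp. Qed.

Lemma view_checked_marked K c : view_of (checked (marked1 K c)) = view_of c.
Proof. by rewrite /view_of /= -!map_comp. Qed.

Lemma view_current c :
  view_of (current c) = set_flags (view_of c) (gI c.2) true (gK c.2).
Proof. by rewrite /view_of /set_flags /current /= -map_comp. Qed.

Definition xok (x : nat) (v : view) : bool := all (fun u => cX u == (u.1.1 == x)) (vlits v).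

Lemma checked_same K c : gS (checked (marked1 K (not_current c))).2 =
  vI (view_of c) && same_sign K (vclause (view_of c)).
Proof.
rewrite /= andbT /live_all /same_sign all_vclause /vlits /= !all_map.
by congr (_ && _); apply: eq_all.
Qed.

Lemma checked_opposite x K c : xok x (view_of c) ->
  gO (checked (marked1 K (not_current c))).2 =
  vI (view_of c) && opposite_sign x K (vclause (view_of c)).
Proof.
rewrite /xok /= andbT /live_all /opposite_sign all_vclause /vlits /= !all_map => /allP xc.
congr (_ && _); apply: eq_in_all => l lc /=.
by have /eqP := xc _ lc; rewrite /cX /= => ->.
Qed.

(** One candidate is processed: a round to pick it, the marking of its literals, a round to check
    coverage, and the counting rounds if it covers all unpeeled clauses. Otherwise it is only
    recorded as tried. *)
Lemma clause_step x st (N := size (enc 0 st)) :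
  has candidate st -> all (xok x) (map view_of st) ->
  exists vs1 v vs2 st',
  [/\ map view_of st = vs1 ++ v :: vs2, vI v && ~~ vT v,
    within (1 + (N.+1 * (N + 3) + (1 + N.+1))) (PickClause, enc 0 st) (PickClause, enc 0 st') &
    map view_of st' =
    if has (fun u => vI u && ~~ covers (vclause v) (vclause u)) (map view_of st)
    then vs1 ++ set_flags v true true (vK v) :: vs2
    else let k := keeps x [seq vclause u | u <- vs1 ++ vs2 & vI u] (vclause v) in
      let clr u := set_flags u (vI u) false (vK u) in
      map clr vs1 ++ set_flags v false false (~~ k) :: map clr vs2].
Proof.
move=> /round_pick_clause[st1 [c [st2 [est cc rnd]]]] xst.
exists (map view_of st1), (view_of c), (map view_of st2).
have w1 := within_round (c := (PickClause, _)) isT rnd.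
have [st' er w2] := mark_loop st1 c st2; rewrite -/(selected st1 c st2) in w1.
have eN : size (enc 0 (selected st1 c st2)) = N by have := within_size w1.
rewrite eN in w2; set K := vclause (view_of c) in er *.
have rc := round_check st'.
have evs : map view_of st = map view_of st1 ++ view_of c :: map view_of st2.
  by rewrite est map_cat.
have e1 : map checked st' = map (fun c => checked (marked1 K (not_current c))) st1 ++
     checked (marked1 K (current c)) :: map (fun c => checked (marked1 K (not_current c))) st2.
  by rewrite -checked_erase er /marked /selected !map_cat /= -!map_comp.
have e2 : has uncovered st' = has (fun u => vI u && ~~ covers K (vclause u)) (map view_of st).
  rewrite -uncovered_erase er has_uncovered_marked est /selected !map_cat /= !has_cat /=.
  rewrite view_current -!map_comp.
  by congr (_ || (_ || _)); rewrite !has_map; apply: eq_has => c' /=; rewrite view_not_current.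
have w3 := within_trans w1 (within_trans w2 (within_round (c := (Check, _)) isT rc)).
rewrite -e2; move: w3; case: ifP => unc w3.
  exists (map checked st'); split=> //.
    by apply: within_le w3; lia.
  rewrite e1 map_cat /= -!map_comp view_checked_marked view_current.
  have -> : gI c.2 = true by case/andP: cc.
  by congr (_ ++ _ :: _); apply: eq_map => c' /=; rewrite view_checked_marked view_not_current.
have w4 := count_loop (map checked st').
set k := _ < _ in w4; exists (map (decide k) (map checked st')); split=> //.
  apply: within_le (within_trans w3 w4); rewrite -!addnA !leq_add2l ltnS.
  apply: leq_trans (count_size _ _) _.
  have /= := within_size w3; rewrite -/N => <-.
  by apply: leq_trans (size_enc_ge 0 _); rewrite leq_addl.
have cnt (p : pred clause) s : count p [seq vclause u | u <- s & vI u] =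
    count (fun u => vI u && p (vclause u)) s.
  by rewrite count_map count_filter; apply: eq_count => u /=; rewrite andbC.
(* The current clause enters neither count: [checked] excludes it through [gC]. *)
have -> : keeps x [seq vclause u | u <- map view_of st1 ++ map view_of st2 & vI u] K = k.
  have xc c' : c' \in st -> xok x (view_of c').
    by move=> c'st; apply: (allP xst); apply: map_f.
  rewrite /keeps /k !cnt e1 !count_cat /= !count_map /= !andbF /= !add0n.
  congr (_ + _ < _ + _); apply: eq_in_count => c' c'st /=.
  - by rewrite -checked_same.
  - by rewrite -checked_same.
  - by rewrite -(@checked_opposite x) //; apply: xc; rewrite est mem_cat c'st.
  - by rewrite -(@checked_opposite x) //; apply: xc; rewrite est mem_cat inE c'st !orbT.
rewrite e1 !map_cat /= -!map_comp; congr (_ ++ _ :: _).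
- apply: eq_map => c' /=; rewrite -[in RHS](view_not_current c') -[in RHS](view_checked_marked K).
  by rewrite /set_flags /view_of /= andbT.
- by rewrite /set_flags /view_of /= -!map_comp andbF.
- apply: eq_map => c' /=; rewrite -[in RHS](view_not_current c') -[in RHS](view_checked_marked K).
  by rewrite /set_flags /view_of /= andbT.
Qed.

(** * The peeling invariant *)

Definition formula (vs : seq view) : cnf := [seq vclause v | v <- vs & ~~ vD v].
Definition unpeeled (vs : seq view) : cnf := [seq vclause v | v <- vs & vI v].
Definition contains (x : nat) (v : view) : bool := x \in vars (vclause v).
Definition with_var (x : nat) (vs : seq view) : cnf := [seq vclause v | v <- vs & contains x v].
Definition kept (x : nat) (a : nat -> bool) (vs : seq view) : nat :=
  count (fun v => [&& contains x v, ~~ vI v, ~~ vK v & ~~ sat_clause a (dropv x (vclause v))]) vs.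
Definition dead_ok (v : view) : bool := vD v ==> all cD (vlits v).
Definition exceeded (vs : seq view) (v : view) : bool :=
  has (fun u => vI u && ~~ covers (vclause v) (vclause u)) vs.

(** The cost equation accumulates the instances of [peel_clause]: peeled clauses that are kept
    already pay their cost without [x]. The last condition keeps, for every rejected clause, a
    witness that it is not the largest. *)
Definition peel_inv (x : nat) (ws : seq (seq core_lit * bool)) (vs : seq view) : Prop :=
  [/\ map fst vs = ws,
      all (fun v => [&& xok x v, dead_ok v, vI v ==> contains x v & vK v ==> contains x v]) vs,
      forall a, minb x a (falsified^~ (unpeeled vs)) + kept x a vs =
                minb x a (falsified^~ (with_var x vs)) &
      forall v, v \in vs -> vI v -> vT v -> exceeded vs v].

Lemma with_var_core x vs vs' : map fst vs = map fst vs' -> with_var x vs = with_var x vs'.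
Proof.
elim: vs vs' => [|[w f] vs IH] [|[w' f'] vs'] //= [-> /IH].
by rewrite /with_var /contains /vclause /vlits /=; case: ifP => _ //= ->.
Qed.

Lemma formula_core vs vs' : map fst vs = map fst vs' -> formula vs = formula vs'.
Proof.
elim: vs vs' => [|[w f] vs IH] [|[w' f'] vs'] //= [-> /IH].
by rewrite /formula /vclause /vlits /vD /=; case: ifP => _ //= ->.
Qed.

Lemma peel_inv_tried x ws vs1 v vs2 (vs := vs1 ++ v :: vs2) :
  peel_inv x ws vs -> vI v -> exceeded vs v ->
  peel_inv x ws (vs1 ++ set_flags v true true (vK v) :: vs2).
Proof.
rewrite {}/vs; case: v => -[ls d] [[[] t] k] [ews okvs cost ex] //= _.
have hE p : (forall u, p u = p (set_flags u (vI u) true (vK u))) ->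
   has p (vs1 ++ (ls, d, (true, true, k)) :: vs2) =
   has p (vs1 ++ (ls, d, (true, t, k)) :: vs2).
  by move=> pE; rewrite !has_cat /= [in RHS]pE.
move=> exv; split.
- by rewrite -ews !map_cat.
- by move: okvs; rewrite !all_cat.
- move=> a; rewrite [unpeeled _](_ : _ = unpeeled (vs1 ++ (ls, d, (true, t, k)) :: vs2)); last first.
    by rewrite /unpeeled !filter_cat !map_cat.
  rewrite [with_var _ _](_ : _ = with_var x (vs1 ++ (ls, d, (true, t, k)) :: vs2)); last first.
    by apply: with_var_core; rewrite !map_cat.
  by rewrite -cost /kept !count_cat.
- move=> w; rewrite mem_cat inE => wvs iw tw; rewrite /exceeded hE //.
  case/or3P: wvs => [w1|/eqP->|w2]; last 2 first.
  + exact: exv.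
  + by apply: ex => //; rewrite mem_cat inE w2 !orbT.
  + by apply: ex => //; rewrite mem_cat w1.
Qed.

Definition untry (v : view) : view := set_flags v (vI v) false (vK v).

(** Coverage of the unpeeled clauses by [v] is just what [peel_clause] asks for. The other clauses
    become untried again, since [v] may have been the witness for their rejection. *)
Lemma peel_inv_peel x ws vs1 v vs2 (vs := vs1 ++ v :: vs2)
    (k := keeps x [seq vclause u | u <- vs1 ++ vs2 & vI u] (vclause v)) :
  peel_inv x ws vs -> vI v -> ~~ exceeded vs v ->
  peel_inv x ws (map untry vs1 ++ set_flags v false false (~~ k) :: map untry vs2).
Proof.
move=> [ews okvs cost ex] iv nex; have := okvs; rewrite /vs all_cat /=.
move=> /and3P[ok1 /and4P[xv dv iv' kv] ok2].
have cv : contains x v by move: iv'; rewrite iv.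
have fE p (s : seq view) : (forall u, p (untry u) = p u) ->
    [seq vclause u | u <- map untry s & p u] = [seq vclause u | u <- s & p u].
  by move=> pE; rewrite filter_map -map_comp; under eq_filter do rewrite /= pE.
have cE p (s : seq view) : (forall u, p (untry u) = p u) -> count p (map untry s) = count p s.
  by move=> pE; rewrite count_map; apply: eq_count => u /=; rewrite pE.
split.
- by rewrite -ews !map_cat /= -!map_comp.
- rewrite all_cat /= !all_map; apply/and3P; split; [exact: ok1| |exact: ok2].
  by apply/and3P; split=> //; apply/implyP.
- move=> a; have := cost a.
  rewrite [with_var x (_ ++ set_flags _ _ _ _ :: _)](_ : _ = with_var x vs); last first.
    by apply: with_var_core; rewrite /vs !map_cat /= -!map_comp.
  move=> <-; rewrite /unpeeled /kept /vs !filter_cat /= !map_cat /= iv !count_cat /= iv /=.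
  rewrite !fE // !cE // negbK andbF.
  rewrite (_ : contains x (set_flags v _ _ _) = true) //.
  rewrite [vclause (set_flags _ _ _ _)]/(vclause v) add0n.
  have pT C : C \in [seq vclause u | u <- vs1 ++ vs2 & vI u] ->
     x \in vars C /\ {subset vars C <= vars (vclause v)}.
    move=> /mapP[u]; rewrite mem_filter mem_cat => /andP[iu uvs] ->; split.
      have : u \in vs by rewrite mem_cat inE; case/orP: uvs => ->; rewrite ?orbT.
      by move=> /(allP okvs)/and4P[_ _]; rewrite iu.
    apply/allP; apply: contraNT nex => nc; apply/hasP; exists u.
      by rewrite mem_cat inE; case/orP: uvs => ->; rewrite ?orbT.
    by rewrite iu.
  have := @peel_clause x [seq vclause u | u <- vs1 ++ vs2 & vI u] (vclause v) a cv
    (fun C h => (pT C h).1) (fun C h => (pT C h).2).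
  rewrite -/k filter_cat map_cat.
  set T1 := [seq vclause u | u <- vs1 & vI u]; set T2 := [seq vclause u | u <- vs2 & vI u].
  rewrite (@eq_minb x a _ (falsified^~ (T1 ++ vclause v :: T2))) => [->|a']; last first.
    by rewrite /falsified !count_cat /= -addnA [count _ T2 + _]addnC.
  by rewrite -!addnA; congr (_ + _); rewrite addnCA.
- move=> w; rewrite mem_cat inE => /or3P[/mapP[u _ ->]|/eqP->|/mapP[u _ ->]] //.
Qed.

(** When stuck, every unpeeled clause fails to cover another one. If [x] were a nest point, that
    other clause would have a strictly larger variable set, and repeating this would exceed any
    size. *)
Lemma peel_inv_not_nest x ws vs : peel_inv x ws vs ->
  has vI vs -> ~~ has (fun v => vI v && ~~ vT v) vs -> ~ nest x (formula vs).
Proof.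
move=> [_ okvs _ ex] /hasP[v0 v0vs iv0] nc nx.
have live v : v \in vs -> vI v -> contains x v && (vclause v \in formula vs).
  move=> vvs iv; have /and4P[_ dv cv _] := allP okvs _ vvs.
  rewrite iv in cv; apply/andP; split=> //; apply/mapP; exists v => //.
  rewrite mem_filter vvs andbT; apply/negP => Dv; move: dv; rewrite /dead_ok Dv /= => /allP aD.
  move: cv => /mapP[l /mapP[u]]; rewrite mem_filter => /andP[nD uv] _ _.
  by rewrite (aD _ uv) in nD.
have grow n : exists v, [/\ v \in vs, vI v & n <= size (undup (vars (vclause v)))].
  elim: n => [|n [v [vvs iv le]]]; first by exists v0.
  have tv : vT v by apply: contraNT nc => tv; apply/hasP; exists v => //; rewrite iv.
  have /hasP[u uvs /andP[iu nuv]] := ex v vvs iv tv.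
  exists u; split=> //; apply: leq_ltn_trans le _.
  have /andP[xv Fv] := live _ vvs iv; have /andP[xu Fu] := live _ uvs iu.
  have [vu|uv] := nx _ _ Fv Fu xv xu; last by case/negP: nuv; apply/allP.
  have [y yu nyv] : exists2 y, y \in vars (vclause u) & y \notin vars (vclause v).
    by apply/allPn.
  have : {subset y :: undup (vars (vclause v)) <= undup (vars (vclause u))}.
    by move=> z; rewrite inE !mem_undup => /orP[/eqP-> //|/vu].
  by move=> /uniq_leq_size; apply; rewrite /= mem_undup nyv undup_uniq.
have [v [vvs _]] := grow (\max_(v <- vs) size (vars (vclause v))).+1.
apply/negP; rewrite -leqNgt; apply: leq_trans (size_undup _) _.
exact: (leq_bigmax_seq (F := fun v => size (vars (vclause v)))).
Qed.

Definition commit_view (v : view) : view :=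
  ([seq (u.1, (cD u || cX u || (vD v || vK v), false, cX u)) | u <- vlits v],
   vD v || vK v, (vI v, vT v, vK v)).

Lemma formula_commit x vs : all (xok x) vs ->
  formula (map commit_view vs) = [seq dropv x (vclause v) | v <- vs & ~~ (vD v || vK v)].
Proof.
move=> ok; rewrite /formula filter_map -map_comp; apply/eq_in_map => v.
rewrite mem_filter /= => /andP[nd /(allP ok) xv].
have {}nd : vD v || vK v = false by apply/negbTE.
rewrite /vclause /dropv [RHS]filter_map -filter_predI /commit_view nd {1}/vlits /=.
rewrite filter_map -map_comp.
rewrite (_ : [seq u <- _ | _] = [seq u <- vlits v | predI (preim fst (fun l => l.1 != x)) (fun u => ~~ cD u) u]) //.
apply: eq_in_filter => u uv; have /eqP /= xu := allP xv _ uv.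
by rewrite /= {1}/cD /= orbF negb_or xu andbC.
Qed.

(** With nothing left to peel, the cost equation says that the kept clauses without [x] cost as much
    as the clauses with [x] at the best value of [x]. The remaining clauses do not depend on [x]. *)
Lemma commit_same_min x ws vs : peel_inv x ws vs -> ~~ has vI vs ->
  same_min (formula vs) (formula (map commit_view vs)).
Proof.
move=> [_ okvs cost _] nI; apply: (same_min_minb (x := x)) => a.
rewrite (@formula_commit x); last by apply: sub_all okvs => v /andP[].
have uE : unpeeled vs = [::].
  rewrite /unpeeled (_ : [seq v <- vs | vI v] = [::]) //.
  by apply/eqP; rewrite -size_eq0 size_filter -leqn0 leqNgt -has_count.
have noI v : v \in vs -> vI v = false.
  by move=> vvs; apply: contraNF nI => iv; apply/hasP; exists v.
pose rest a' := count (fun v => [&& ~~ vD v, ~~ contains x v & ~~ sat_clause a' (vclause v)]) vs.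
have restE b : rest (assign a x b) = rest a.
  apply: eq_count => v; case cv: (contains x v); rewrite /= ?andbF //.
  by rewrite sat_assign_notin //; apply/negbT.
have live v : v \in vs -> contains x v -> vD v = false.
  move=> /(allP okvs)/and4P[_ dv _ _] /mapP[l /mapP[u]].
  rewrite mem_filter => /andP[nD uv] _ _; apply: contraTF dv => Dv.
  by rewrite /dead_ok Dv; apply/allPn; exists u.
have fE a' : falsified a' (formula vs) = rest a' + falsified a' (with_var x vs).
  rewrite /falsified /formula /with_var /rest !count_map !count_filter.
  rewrite -count_predUI [X in _ + X](_ : _ = 0) ?addn0.
    apply: eq_in_count => v vvs /=; case cv: (contains x v) => /=; rewrite ?andbT ?andbF ?orbF.
      by rewrite live ?andbT.
    by rewrite andbC.
  by rewrite (eq_count (a2 := pred0)) ?count_pred0 // => v /=; case: (contains x v); rewrite ?andbF.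
have -> : minb x a (falsified^~ (formula vs)) = rest a + minb x a (falsified^~ (with_var x vs)).
  by rewrite /minb !fE !restE addn_minr.
rewrite -cost uE /minb /= minnn add0n /falsified count_map count_filter /rest /kept.
rewrite -count_predUI [X in _ = _ + X](_ : _ = 0) ?addn0.
  apply: eq_in_count => v vvs /=; have /and4P[_ _ _ kv] := allP okvs _ vvs.
  case cv: (contains x v) => /=; rewrite ?andbT ?andbF ?orbF.
    by rewrite live // noI //= andbC.
  have -> : vK v = false by apply: contraTF kv => ->; rewrite cv.
  by rewrite orbF andbC dropv_id //; apply/negbT.
by rewrite (eq_count (a2 := pred0)) ?count_pred0 // => v /=; case: (contains x v); rewrite ?andbF.
Qed.

(** * The peeling loop and the number of rounds *)

(** In [peel_bound] and [main_bound], the factor [N * N.+1 + N] bounds a lexicographic measure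
    written as one number. *)
Definition clause_bound (N : nat) : nat := 1 + (N.+1 * (N + 3) + (1 + N.+1)).
Definition peel_bound (N : nat) : nat := (N * N.+1 + N).+1 * clause_bound N.
Definition elim_bound (N : nat) : nat := (N + 3) + (peel_bound N + 1).
Definition main_bound (N : nat) : nat := (N * N.+1 + N).+1 * elim_bound N.

Lemma view_erase st st' : erase st = erase st' -> map view_of st = map view_of st'.
Proof.
have e s : map view_of s = map view_of (erase s).
  by rewrite -map_comp; apply: eq_map => c; rewrite /view_of /= -map_comp.
by move=> h; rewrite e h -e.
Qed.

Lemma views_not_current st : map view_of (map not_current st) = map view_of st.
Proof. by rewrite -map_comp; apply: eq_map => c; rewrite /= view_not_current. Qed.

Lemma views_committed st : map view_of (map committed st) = map commit_view (map view_of st).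
Proof.
rewrite -!map_comp; apply: eq_map => c; rewrite /= /view_of /commit_view /vlits /= -!map_comp.
by [].
Qed.

Definition vcandidate (v : view) : bool := vI v && ~~ vT v.

Lemma has_candidate st : has vcandidate (map view_of st) = has candidate st.
Proof. by rewrite has_map; apply: eq_has. Qed.

(** Lexicographic measure: peeling lowers the number of unpeeled clauses, though it resets the tried
    ones; a rejection lowers the number of candidates. *)
Lemma peel_loop x ws st (N := size (enc 0 st)) : peel_inv x ws (map view_of st) ->
  exists2 st', peel_inv x ws (map view_of st') /\ ~~ has vcandidate (map view_of st') &
    within (peel_bound N) (PickClause, enc 0 st)
      (if has vI (map view_of st') then PickVar else Commit, enc 0 st').
Proof.
move=> I0.
pose I s := size (enc 0 s) = N /\ peel_inv x ws (map view_of s).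
pose mu s := count vI (map view_of s) * (size s).+1 + count vcandidate (map view_of s).
pose post c := exists2 st', peel_inv x ws (map view_of st') /\ ~~ has vcandidate (map view_of st') &
   c = (if has vI (map view_of st') then PickVar else Commit, enc 0 st').
have szN s : size (enc 0 s) = N -> size s <= N.
  by move=> <-; apply: leq_trans (size_enc_ge 0 s); apply: leq_addl.
have step s : I s ->
    (exists2 c', within (clause_bound N) (PickClause, enc 0 s) c' & post c') \/
    (exists s', [/\ I s', mu s' < mu s &
       within (clause_bound N) (PickClause, enc 0 s) (PickClause, enc 0 s')]).
  move=> [szs Is]; have [hc|hc] := boolP (has candidate s); last first.
    left; exists (if has vI (map view_of s) then PickVar else Commit, enc 0 (map not_current s)).
      apply: (@within_le 1) => //; apply: within_round => //.
      by rewrite round_pick_clause_none // has_map; congr (_, _).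
    by exists (map not_current s); rewrite views_not_current // has_candidate.
  right; have xs : all (xok x) (map view_of s).
    by have [_ ok _ _] := Is; apply: sub_all ok => v /andP[].
  have [vs1 [v [vs2 [s' [evs /andP[iv tv] w es']]]]] := clause_step hc xs.
  exists s'; have szs' : size (enc 0 s') = N by have /= := within_size w; rewrite szs.
  rewrite szs in w; split=> //.
    split=> //; rewrite es'; case: ifP => ex; rewrite evs in Is ex.
      exact: peel_inv_tried.
    by apply: peel_inv_peel => //; rewrite /exceeded ex.
  have sz : size s' = size s.
    rewrite -(size_map view_of s') -(size_map view_of s) es' evs.
    by case: ifP; rewrite !size_cat /= ?size_map.
  rewrite /mu sz es' evs; case: ifP => _; rewrite !count_cat /= /vcandidate iv tv /=.
    by lia.
  rewrite /vI /= -/vI; set n1 := count vI _; set n2 := count vI (map _ vs2).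
  have e1 : n1 = count vI vs1 by rewrite /n1 count_map.
  have e2 : n2 = count vI vs2 by rewrite /n2 count_map.
  set m1 := count _ (map _ vs1); set m2 := count _ (map _ vs2).
  have : m1 + m2 < size s.
    have : m1 <= size vs1 by rewrite /m1 -(size_map (fun u => set_flags u (vI u) false (vK u)) vs1) count_size.
    have : m2 <= size vs2 by rewrite /m2 -(size_map (fun u => set_flags u (vI u) false (vK u)) vs2) count_size.
    by rewrite -(size_map view_of s) evs size_cat /=; lia.
  by rewrite e1 e2; nia.
have [c' w [st' pst' ec']] := within_loop (conf := fun s => (PickClause, enc 0 s)) step (conj erefl I0 : I st).
exists st' => //; rewrite -ec'; apply: within_le w; rewrite leq_mul2r; apply/orP; right.
rewrite ltnS; apply: leq_add; first apply: leq_mul.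
- by apply: leq_trans (count_size _ _) _; rewrite size_map szN.
- by rewrite ltnS szN.
- by apply: leq_trans (count_size _ _) _; rewrite size_map szN.
Qed.

(** * Eliminating all variables *)

Definition prep_lit (x : nat) (u : core_lit) : core_lit :=
  (u.1, (cD u, cT u || (u.1.1 == x), u.1.1 == x)).
Definition prep_view (x : nat) (v : view) : view :=
  (map (prep_lit x) (vlits v), vD v, (contains x v, false, false)).

Lemma views_prepare x st : map view_of (prepare x st) = map (prep_view x) (map view_of st).
Proof.
rewrite -!map_comp; apply: eq_map => c; rewrite /= /view_of /prep_view /vlits /= -!map_comp.
congr (_, _, (_, _, _)); rewrite /contains /vars /vclause /vlits /=.
apply/hasP/mapP => [[l lc /andP[Dl /eqP xl]]|[k /mapP[u]]].
  exists l.1 => //; apply/mapP; exists (core_of l) => //.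
  by rewrite mem_filter Dl; apply: map_f.
rewrite mem_filter => /andP[Du /mapP[l lc eu]] ek xk; exists l => //.
by rewrite eu in Du ek; rewrite Du xk ek eqxx.
Qed.

Lemma vclause_prep x v : vclause (prep_view x v) = vclause v.
Proof. by rewrite /vclause /vlits /= filter_map -map_comp. Qed.

Lemma formula_prep x vs : formula (map (prep_view x) vs) = formula vs.
Proof.
by rewrite /formula filter_map -map_comp; apply: eq_map => v; rewrite /= vclause_prep.
Qed.

Lemma peel_inv_prep x vs (vs' := map (prep_view x) vs) :
  all dead_ok vs -> peel_inv x (map fst vs') vs'.
Proof.
move=> dvs.
have cI v : v \in vs' -> vI v = contains x v.
  by move=> /mapP[u _ ->]; rewrite /contains vclause_prep.
split=> //.
- apply/allP => v v'; apply/and4P; split; last by case/mapP: v' => u _ ->.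
  + by case/mapP: v' => u _ ->; apply/allP => w /mapP[w' _ ->] /=.
  + case/mapP: v' => u uvs ->; have := allP dvs _ uvs.
    by rewrite /dead_ok /vlits /= all_map.
  + by rewrite cI //; apply/implyP.
- move=> a; rewrite /unpeeled (eq_in_filter cI) /kept (eq_in_count (a2 := pred0)) ?count_pred0 ?addn0 //.
  by move=> v /cI /= ->; case: (contains x v).
- by move=> v /mapP[u _ ->].
Qed.

(** The last condition makes failed attempts count: once every live literal is tried, no live
    variable is a nest point. Clauses are flagged but never erased, so [size vs] stays fixed and
    deleted clauses can be counted at the end. *)
Definition outer_inv (F : cnf) (vs : seq view) : Prop :=
  [/\ same_min F (formula vs), (exists s, elim_order s (formula vs)), all dead_ok vs,
      size vs = size F &
      forall v u, v \in vs -> u \in vlits v -> ~~ cD u -> cT u -> ~ nest u.1.1 (formula vs)].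

Definition all_lits (vs : seq view) : seq core_lit := flatten (map vlits vs).
Definition cuntried (u : core_lit) : bool := ~~ cD u && ~~ cT u.
Definition outer_measure (N : nat) (vs : seq view) : nat :=
  count (fun u => ~~ cD u) (all_lits vs) * N.+1 + count cuntried (all_lits vs).

Lemma all_lits_core vs vs' : map fst vs = map fst vs' -> all_lits vs = all_lits vs'.
Proof.
move=> e; rewrite /all_lits; congr flatten.
have h s : map vlits s = map fst (map fst s) by rewrite -map_comp.
by rewrite !h e.
Qed.

Lemma all_lits_views st : all_lits (map view_of st) = map core_of (lits st).
Proof.
by elim: st => //= c st IH; rewrite /all_lits /lits /= map_cat -/(all_lits _) IH.
Qed.

Lemma all_lits_prep x vs : all_lits (map (prep_view x) vs) = map (prep_lit x) (all_lits vs).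
Proof. by elim: vs => //= v vs IH; rewrite /all_lits /= map_cat -/(all_lits _) IH. Qed.

Lemma count_commit_lt vs v : v \in vs -> has (fun u => ~~ cD u && cX u) (vlits v) ->
  count (fun u => ~~ cD u) (all_lits (map commit_view vs)) <
  count (fun u => ~~ cD u) (all_lits vs).
Proof.
have le w : count (fun u => ~~ cD u) (vlits (commit_view w)) <= count (fun u => ~~ cD u) (vlits w).
  by rewrite /vlits /= count_map; apply: sub_count => u; rewrite /= {1}/cD /= !negb_or -andbA => /andP[].
move=> vvs hv.
have lt : count (fun u => ~~ cD u) (vlits (commit_view v)) < count (fun u => ~~ cD u) (vlits v).
  rewrite /vlits /= count_map; have /hasP[u uv /andP[Du Xu]] := hv.
  apply: (count_lt (x := u)) => //= [w|]; rewrite {1}/cD /= ?Xu ?orbT //.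
  by rewrite !negb_or -andbA => /andP[].
rewrite /all_lits; elim: vs vvs => //= w vs IH; rewrite !count_cat inE.
case/orP => [/eqP<-|/IH h]; last by rewrite -addnS leq_add.
rewrite -addSn leq_add //; elim: {IH} vs => //= w' vs IH.
by rewrite !count_cat leq_add.
Qed.

(** Either the attempt is abandoned, the formula is unchanged and fewer literals are untried, or it
    is committed and fewer literals are live. *)
Lemma elim_step F st (N := size (enc 0 st)) :
  outer_inv F (map view_of st) -> has (fun l : alit => untried l.2) (lits st) ->
  exists st', [/\ outer_inv F (map view_of st'),
    outer_measure N (map view_of st') < outer_measure N (map view_of st) &
    within (elim_bound N) (PickVar, enc 0 st) (PickVar, enc 0 st')].
Proof.
move=> [smin [s es] dvs szF tried] /pick_variable[l0 [l0st ul0 w1]].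
set x := l0.1.1 in w1 *; set vs := map view_of st in smin es dvs szF tried *.
have szN : size (enc 0 (prepare x st)) = N by have := within_size w1.
have Ipre := peel_inv_prep x dvs; rewrite -views_prepare in Ipre.
have [st' [Ist' nc] w2] := peel_loop Ipre; rewrite szN in w2.
have [core _ _ _] := Ist'; rewrite views_prepare in core.
have feq : formula (map view_of st') = formula vs by rewrite (formula_core core) formula_prep.
have leq' : all_lits (map view_of st') = map (prep_lit x) (all_lits vs).
  by rewrite (all_lits_core core) all_lits_prep.
have l0vs : core_of l0 \in all_lits vs by rewrite all_lits_views; apply: map_f.
have szl : size (all_lits vs) <= N.
  by rewrite all_lits_views size_map; apply: leq_trans (size_enc_ge 0 st); apply: leq_addr.
have dvs' : all dead_ok (map view_of st').
  by have [_ ok _ _] := Ist'; apply: sub_all ok => v /and4P[].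
have sz' : size (map view_of st') = size F.
  by rewrite -(size_map fst) core !size_map -szF size_map.
case: ifP w2 => [hI|/negbT nI] w2.
  exists st'; split.
  - split=> //; rewrite ?feq //; first by exists s.
    move=> v u vst uv Du Tu.
    have : u \in all_lits (map view_of st').
      by apply/flattenP; exists (vlits v) => //; apply: map_f.
    rewrite leq' => /mapP[u' /flattenP[_ /mapP[v' v'vs ->] u'v'] eu].
    move: Du Tu; rewrite eu /= /prep_lit {1}/cD /cT /= => Du /orP[Tu|/eqP ->].
      exact: tried v'vs u'v' Du Tu.
    by rewrite -feq; apply: peel_inv_not_nest Ist' hI nc.
  - rewrite /outer_measure leq' !count_map; set n := count _ _; set m := count _ _.
    have -> : n = count (fun u => ~~ cD u) (all_lits vs) by apply: eq_count.
    rewrite ltn_add2l; apply: (count_lt (x := core_of l0)) => //.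
    + by move=> u /=; rewrite /cuntried /cD /cT /= negb_or => /and3P[-> ->].
    + by rewrite /cuntried /cD /cT /= eqxx orbT andbF.
  - by apply: within_le (within_trans w1 w2); rewrite /elim_bound; lia.
exists (map committed st'); rewrite views_committed; split.
- split.
  + by apply: same_min_trans smin _; rewrite -feq; apply: commit_same_min Ist' nI.
  + exists s; apply: elim_order_sub es => C; rewrite (@formula_commit x); last first.
      by have [_ ok _ _] := Ist'; apply: sub_all ok => v /and4P[].
    move=> /mapP[v]; rewrite mem_filter negb_or => /andP[/andP[Dv _] vst] ->.
    exists (vclause v) => [|y]; last by rewrite vars_dropv.
    by rewrite -feq; apply/mapP; exists v => //; rewrite mem_filter Dv.
  + apply/allP => _ /mapP[v _ ->]; rewrite /dead_ok /vlits /vD /= all_map; apply/implyP => d.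
    by apply/allP => u _ /=; rewrite /cD /= d orbT.
  + by rewrite size_map.
  + by move=> _ u /mapP[v _ ->] /mapP[u' _ ->].
- rewrite /outer_measure.
  have lt : count (fun u => ~~ cD u) (all_lits (map commit_view (map view_of st'))) <
      count (fun u => ~~ cD u) (all_lits vs).
    have -> : count (fun u => ~~ cD u) (all_lits vs) =
        count (fun u => ~~ cD u) (all_lits (map view_of st')).
      by rewrite leq' count_map; apply: eq_count.
    have : prep_lit x (core_of l0) \in all_lits (map view_of st') by rewrite leq'; apply: map_f.
    move=> /flattenP[_ /mapP[v vst ->] uv]; apply: (count_commit_lt vst).
    apply/hasP; exists (prep_lit x (core_of l0)) => //.
    by case/andP: ul0 => Dl0 _; rewrite /cD /cX /= Dl0 eqxx.
  have : count cuntried (all_lits (map commit_view (map view_of st'))) <= N.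
    apply: leq_trans (count_size _ _) _; apply: leq_trans szl.
    rewrite -(size_map (prep_lit x) (all_lits vs)) -leq'.
    suff -> : size (all_lits (map commit_view (map view_of st'))) =
        size (all_lits (map view_of st')) by [].
    rewrite /all_lits; elim: (map view_of st') => //= v vs' IH.
    by rewrite !size_cat IH /vlits /= size_map.
  by move: lt; nia.
- have w3 := within_round (c := (Commit, _)) isT (round_commit st').
  by apply: within_le (within_trans w1 (within_trans w2 w3)).
Qed.

Lemma main_loop F st (N := size (enc 0 st)) : outer_inv F (map view_of st) ->
  exists st', [/\ is_maxsat_value F (count (fun c : aclause => gD c.2) st'),
    size st' <= N & within (main_bound N) (PickVar, enc 0 st) (Fin0, enc 0 st')].
Proof.
move=> I0.
pose I s := size (enc 0 s) = N /\ outer_inv F (map view_of s).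
pose post c := exists2 st', is_maxsat_value F (count (fun c : aclause => gD c.2) st') &
   c = (Fin0, enc 0 st').
have step s : I s ->
    (exists2 c', within (elim_bound N) (PickVar, enc 0 s) c' & post c') \/
    (exists s', [/\ I s', outer_measure N (map view_of s') < outer_measure N (map view_of s) &
       within (elim_bound N) (PickVar, enc 0 s) (PickVar, enc 0 s')]).
  move=> [szs Is]; have [hu|hu] := boolP (has (fun l : alit => untried l.2) (lits s)).
    right; have [s' [Is' lt w]] := elim_step Is hu; rewrite szs in lt w.
    by exists s'; split=> //; split=> //; have /= := within_size w; rewrite szs.
  left; have [s' er w] := pick_variable_none hu; exists (Fin0, enc 0 s').
    by apply: within_le w; rewrite /elim_bound; lia.
  exists s' => //; have {w} [smin [o eo] dvs szF tried] := Is.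
  set vs := map view_of s in smin eo dvs szF tried.
  (* A live literal would yield a nest point among the live variables, which would have been tried,
     contradicting the invariant. *)
  have dead v u : v \in vs -> u \in vlits v -> cD u.
    move=> vvs uv; apply: contraT => Du.
    have live w z : w \in vs -> z \in vlits w -> ~~ cD z -> vclause w \in formula vs.
      move=> wvs zw Dz; apply/mapP; exists w => //; rewrite mem_filter wvs andbT.
      by apply: contra Dz => Dw; have := allP dvs _ wvs; rewrite /dead_ok Dw => /allP; apply.
    have inl w z : z \in vlits w -> ~~ cD z -> z.1.1 \in vars (vclause w).
      move=> zw Dz; apply/mapP; exists z.1 => //; apply/mapP; exists z => //.
      by rewrite mem_filter Dz.
    have [C [y [/mapP[w]]]] := elim_order_nest eo (live _ _ vvs uv Du) (inl _ _ uv Du).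
    rewrite mem_filter => /andP[_ wvs] ->.
    move=> /mapP[k /mapP[z]]; rewrite mem_filter => /andP[Dz zw] -> -> ny.
    have Tz : cT z.
      apply: contraNT hu => Tz; rewrite -(has_map core_of cuntried) -all_lits_views.
      apply/hasP; exists z; last by rewrite /cuntried Dz Tz.
      by apply/flattenP; exists (vlits w) => //; apply: map_f.
    by case: (tried _ _ wvs zw Dz Tz).
  (* Every clause not deleted is now empty, hence falsified by all assignments. *)
  have fE a : falsified a (formula vs) = count (fun v => ~~ vD v) vs.
    rewrite /falsified /formula count_map count_filter; apply: eq_in_count => v vvs /=.
    rewrite /vclause (_ : [seq u <- vlits v | ~~ cD u] = [::]) //.
    rewrite -(filter_pred0 (vlits v)); apply: eq_in_filter => u uv.
    by rewrite (dead _ _ vvs uv).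
  have := same_min_value smin fE; rewrite -szF.
  have <- : count vD vs = count (fun c : aclause => gD c.2) s'.
    by rewrite /vs -(view_erase er) count_map.
  by rewrite -(count_predC vD vs) addnK.
have [c' w [st' mst' ec']] := within_loop (conf := fun s => (PickVar, enc 0 s)) step (conj erefl I0 : I st).
exists st'; split=> //.
  have /= := within_size w; rewrite ec' /= -/N => <-.
  by apply: leq_trans (size_enc_ge 0 st'); apply: leq_addl.
rewrite -ec'; apply: within_le w; rewrite leq_mul2r; apply/orP; right.
have szl : size (all_lits (map view_of st)) <= N.
  by rewrite all_lits_views size_map; apply: leq_trans (size_enc_ge 0 st); apply: leq_addr.
rewrite ltnS; apply: leq_add; first apply: leq_mul => //;
  exact: leq_trans (count_size _ _) szl.
Qed.

(** * Writing the result in binary *)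

Definition out_cells (s : seq (bool * bool)) : seq cell := [seq COut p.1 p.2 | p <- s].

Lemma pass_id_out q s : scanr pass_id q (out_cells s) = (q, out_cells s).
Proof. by elim: s => //= p s ->. Qed.

Lemma round_fin0 st : exists s : seq (bool * bool),
  [/\ mround (Fin0, enc 0 st) = (Fin, out_cells s), size s = size (enc 0 st),
      count fst s = count (fun c : aclause => gD c.2) st & bits_val (map snd s) = 0].
Proof.
pose f c := (if c is CEnd g then gD g else false, false).
exists (map f (enc 0 st)); split; last 3 first.
- by rewrite size_map.
- rewrite count_map; elim: st => //= c st IH; rewrite /enc /= !count_cat -/(enc 0 st) IH /=.
  suff -> : count (preim f fst) (flatten [seq enc_alit 0 i | i <- c.1]) = 0 by rewrite addn0.
  elim: c.1 => //= l ls IHl; rewrite count_cat IHl addn0.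
  by rewrite count_cat !count_map; do 2 rewrite (eq_count (a2 := pred0)) ?count_pred0 //.
- by rewrite -map_comp; elim: (enc 0 st).
- have e s q : scan fin0_fw q s = (q, out_cells (map f s)) by elim: s => //= c s ->.
  by rewrite /round /= e pass_id_out.
Qed.

Lemma scan_fin_fw b s (r := scan fin_fw (bst b b false false) (out_cells s)) :
  exists2 s', r = (bst (b || has fst s) (b || has fst s) false false, out_cells s') &
    map snd s' = map snd s /\ count fst s' = count fst s - ~~ b.
Proof.
rewrite {}/r; elim: s b => [|[m c] s IH] b; first by exists [::]; rewrite ?orbF.
have [s' e [e1 e2]] := IH (b || m); rewrite /= [ms1 _]/= e /=.
exists ((b && m, c) :: s'); first by rewrite orbA.
by rewrite /= e1 e2; split=> //; case: b {IH e e2}; case: m => //=; lia.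
Qed.

Lemma scanr_fin_bw b c s : exists c' s',
  [/\ scanr fin_bw (bst b c false false) (out_cells s) = (bst b c' false false, out_cells s'),
      size s' = size s, count fst s' = count fst s &
      bits_val (map snd s') + c' * 2 ^ size s = bits_val (map snd s) + c].
Proof.
elim: s => [|[m d] s [c' [s' [e sz cn v]]]]; first by exists c, [::]; rewrite muln1.
exists (c' && d), ((m, c' (+) d) :: s'); split; rewrite /= ?sz ?cn ?e //.
rewrite !bits_val_cons !size_map sz expnS.
by move: v; case: c' {e}; case: d => /=; lia.
Qed.

(** The bound on the new value forces the carry out of the leftmost cell to be 0. *)
Lemma round_fin s : bits_val (map snd s) + has fst s < 2 ^ size s -> exists s',
  [/\ mround (Fin, out_cells s) = (if has fst s then Fin else Out, out_cells s'),
      size s' = size s, count fst s' = (count fst s).-1 &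
      bits_val (map snd s') = bits_val (map snd s) + has fst s].
Proof.
move=> lt; rewrite /round /= [ms0]/(bst false false false false).
have [s1 -> [e1 e2]] := scan_fin_fw false s.
have [c' [s2 [-> sz cn v]]] := scanr_fin_bw (has fst s) (has fst s) s1.
have sz1 : size s1 = size s by rewrite -(size_map snd) e1 size_map.
exists s2; split=> //; first by rewrite sz sz1.
  by rewrite cn e2 subn1.
move: v; rewrite e1 sz1; case: c' => /=; lia.
Qed.

(** One round per mark, one finding no mark, and one turning counter cells into output symbols. *)
Lemma fin_loop s : bits_val (map snd s) + count fst s < 2 ^ size s -> exists bs,
  [/\ size bs = size s, bits_val bs = bits_val (map snd s) + count fst s &
   within ((count fst s).+2) (Fin, out_cells s) (Halt, [seq CBit b false | b <- bs])].
Proof.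
move e: (count fst s) => n; elim: n s e => [|n IH] s e lt.
  have hs : has fst s = false by rewrite has_count e.
  have [|s' [rnd sz cn v]] := @round_fin s; first by rewrite hs.
  exists (map snd s'); rewrite size_map v hs; split=> //.
  rewrite hs in rnd; apply: within_trans (within_round _ rnd) (_ : within 1 _ _) => //.
  apply: within_round => //; rewrite /round /=.
  have -> q : scan out_fw q (out_cells s') = (q, [seq CBit b false | b <- map snd s']).
    by elim: (s') => //= p t ->.
  rewrite (_ : scanr _ _ _ = (ms0, [seq CBit b false | b <- map snd s'])) //=.
  by elim: (s') => //= p t ->.
have hs : has fst s = true by rewrite has_count e.
have [|s' [rnd sz cn v]] := @round_fin s; first by rewrite hs; apply: leq_ltn_trans lt; lia.
rewrite hs in rnd v; have [||bs [szb vb w]] := IH s'; first by rewrite cn e.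
  by rewrite v sz; apply: leq_ltn_trans lt; lia.
exists bs; split; [by rewrite szb|by rewrite vb v -addnA|].
by rewrite -add1n; apply: within_trans w; apply: within_round.
Qed.

(** * The machine *)

Definition lflags0 := LF false false false false false false false false.
Definition cflags0 := CF false false false false false false false.

Definition sym_cell (s : Sym) : cell :=
  match s with
  | S_0 => CBit false false
  | S_1 => CBit true false
  | S_pos => CLit true lflags0
  | S_neg => CLit false lflags0
  | S_end => CEnd cflags0
  | S_blank => COut false false
  end.

Lemma sym_cell_inj s t : s <> S_blank -> t <> S_blank -> sym_cell s = sym_cell t -> s = t.
Proof. by case: s; case: t. Qed.

(** A numeral with leading digit 1 is determined by its value: the value fixes its length, and the
    length and the value fix its digits. *)
Lemma strip_bits bs : strip_zeros sym_cell [seq CBit b false | b <- bs] =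
  [seq CBit b false | b <- nbits (bits_val bs)].
Proof.
elim: bs => // -[] bs IH; rewrite bits_val_cons; last by rewrite /= IH.
rewrite mul1n map_cons -[RHS]/([seq CBit b false | b <- nbits (2 ^ size bs + bits_val bs)]).
rewrite (_ : strip_zeros _ _ = [seq CBit b false | b <- true :: bs]) //.
congr map; set n := _ + _; have n0 : 0 < n by rewrite addn_gt0 expn_gt0.
have [s es] := nbits_head n0; have := nbitsK n; rewrite es bits_val_cons mul1n => en.
congr cons; have := bits_val_lt s; have := bits_val_lt bs; rewrite /n in en => lt1 lt2.
have sz : size bs = size s.
  have [lt|lt|//] := ltngtP (size bs) (size s).
    have : 2 ^ (size bs).+1 <= 2 ^ size s by rewrite leq_exp2l.
    by rewrite expnS; lia.
  have : 2 ^ (size s).+1 <= 2 ^ size bs by rewrite leq_exp2l.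
  by rewrite expnS; lia.
by apply: bits_val_inj => //; move: en; rewrite sz; lia.
Qed.

Definition initial (F : cnf) : seq aclause :=
  [seq ([seq (l, lflags0) | l <- C], cflags0) | C <- F].

Lemma enc_initial F : map sym_cell (enc_cnf F) = enc 0 (initial F).
Proof.
have bitsE n : map sym_cell (nat_bits n) = enc_bits 0 (nbits n).
  rewrite nat_bitsE /enc_bits subn0 take_size drop_size cats0 -map_comp.
  by apply: eq_map => -[].
rewrite /enc_cnf /enc map_flatten /initial -!map_comp; congr flatten; apply: eq_map => C /=.
rewrite /enc_clause /enc_aclause map_cat map_flatten -!map_comp; congr (flatten _ ++ _).
by apply: eq_map => -[x b] /=; rewrite /enc_lit /enc_alit /= bitsE; case: b.
Qed.

Lemma outer_inv_initial F : beta_acyclic (hyp_of_cnf F) ->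
  outer_inv F (map view_of (initial F)).
Proof.
move=> /beta_acyclic_elim_order[s es].
have fE : formula (map view_of (initial F)) = F.
  rewrite /formula /initial -map_comp filter_map -map_comp (eq_filter (a2 := predT)) // filter_predT.
  rewrite -[RHS]map_id; apply: eq_map => C /=.
  rewrite /vclause /vlits /= -map_comp filter_map -map_comp (eq_filter (a2 := predT)) // filter_predT.
  by rewrite -[RHS]map_id; apply: eq_map.
split; rewrite ?fE.
- exact: same_min_refl.
- by exists s.
- by apply/allP => _ /mapP[_ /mapP[C _ ->] ->].
- by rewrite !size_map.
- by move=> _ u /mapP[_ /mapP[C _ ->] ->] /mapP[_ /mapP[l _ ->] ->].
Qed.

Lemma enc_cnf_nonblank F s : List.In s (enc_cnf F) -> s <> S_blank.
Proof.
have bits n t : List.In t (nat_bits n) -> t <> S_blank.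
  by rewrite nat_bitsE; elim: (nbits n) => //= b bs IH [<-|/IH]; case: b.
have inc (p q : seq Sym) t : List.In t (p ++ q) -> List.In t p \/ List.In t q.
  by elim: p => /= [|x p IH]; [right|move=> [->|/IH[]]; auto].
rewrite /enc_cnf; elim: F => //= C F IH /inc[|/IH //].
rewrite /enc_clause => /inc[|[<-|//]] //; elim: C => //= l C IHC [<-|/inc[/bits|]] //.
by case: l.2.
Qed.

(** * Polynomial time bound *)

Definition poly_bounded (f : nat -> nat) : Prop := exists c k, forall N, f N <= c * N.+1 ^ k.

Lemma poly_bounded_const c : poly_bounded (fun=> c).
Proof. by exists c, 0 => N; rewrite muln1. Qed.

Lemma poly_bounded_id : poly_bounded id.
Proof. by exists 1, 1 => N; rewrite mul1n expn1 leqnSn. Qed.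

Lemma poly_bounded_add f g : poly_bounded f -> poly_bounded g -> poly_bounded (fun N => f N + g N).
Proof.
move=> [c [k hf]] [d [l hg]]; exists (c + d), (k + l) => N; rewrite mulnDl.
apply: leq_add; [apply: leq_trans (hf N) _|apply: leq_trans (hg N) _].
  by rewrite leq_mul2l leq_pexp2l ?leq_addr ?orbT.
by rewrite leq_mul2l leq_pexp2l ?leq_addl ?orbT.
Qed.

Lemma poly_bounded_mul f g : poly_bounded f -> poly_bounded g -> poly_bounded (fun N => f N * g N).
Proof.
move=> [c [k hf]] [d [l hg]]; exists (c * d), (k + l) => N; rewrite expnD mulnACA.
exact: leq_mul.
Qed.

Lemma poly_bounded_succ f : poly_bounded f -> poly_bounded (fun N => (f N).+1).
Proof.
move=> [c [k h]]; exists c.+1, k => N; rewrite mulSn -add1n leq_add // expn_gt0 //.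
Qed.

(** The rounds of the elimination, one to set up the counter and at most [N + 2] to count, each
    taking [2 * N + 2] steps; finally at most [N + 1] steps to strip zeros. *)
Definition total_bound (N : nat) : nat :=
  (main_bound N + (1 + N.+2)) * (N + N + 2) + N.+1.

Lemma poly_bounded_total : poly_bounded total_bound.
Proof.
rewrite /total_bound /main_bound /elim_bound /peel_bound /clause_bound.
by repeat first [exact: poly_bounded_const | exact: poly_bounded_id
  | apply: poly_bounded_add | apply: poly_bounded_mul | apply: poly_bounded_succ].
Qed.

Lemma start_not_halt : PickVar != Halt.
Proof. exact/eqP. Qed.

Definition maxsat_tm : TM := rm_tm mfw mbw ms0 mnext PickVar Halt sym_cell_inj.
Theorem mainTheorem3 :
  exists (M : TM) (c k : nat),
    forall F : cnf, wf_cnf F -> beta_acyclic (hyp_of_cnf F) ->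
      exists t : nat,
        t <= c * (size (enc_cnf F)).+1 ^ k /\
        halted (tm_run t (tm_init M (enc_cnf F))) /\
        exists m : nat, is_maxsat_value F m /\
          tm_output (tm_run t (tm_init M (enc_cnf F))) = map (tm_sym M) (nat_bits m).
Proof.
have [c [k bnd]] := poly_bounded_total.
exists maxsat_tm, c, k => F _ /outer_inv_initial inv.
set N := size (enc_cnf F).
have szN : size (enc 0 (initial F)) = N by rewrite -enc_initial size_map.
have [st [val szst w1]] := main_loop inv; rewrite szN in szst w1.
have szN' : size (enc 0 st) = N by have /= := within_size w1; rewrite szN.
have [s [rnd0 szs cnt v0]] := round_fin0 st.
set m := count _ st in val cnt.
have mN : m <= N by apply: leq_trans (count_size _ _) szst.
have [|bs [szb vb w3]] := @fin_loop s.
  (* The counter is as wide as the tape and cannot overflow, as [m <= N < 2 ^ N]. *)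
  by rewrite v0 cnt szs szN' add0n (leq_ltn_trans mN) // ltn_expl.
have w2 := within_round (c := (Fin0, enc 0 st)) isT rnd0.
have [n nle run] := within_trans w1 (within_trans w2 w3).
rewrite -enc_initial in run.
have [t tle [hlt out]] := rm_computes sym_cell_inj start_not_halt (@enc_cnf_nonblank F) run.
exists t; split; [|split=> //; exists m; split=> //].
  apply: leq_trans tle (leq_trans _ (bnd N)).
  rewrite size_map szb szs szN' /total_bound -addnn leq_add2r leq_mul2r; apply/orP; right.
  by apply: leq_trans nle _; rewrite !leq_add2l cnt !ltnS.
rewrite /maxsat_tm out strip_bits vb v0 add0n cnt nat_bitsE -!map_comp.
by apply: eq_map => -[].
Qed.
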